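(* Let $u\in C^2(\mathbb{R}^2\setminus\{0\})\cap C(\mathbb{R}^2)$ be a bounded real-valued function satisfying $$-\Delta u=\frac{2}{|x|^2}\,u\,(1-u^2)\quad\text{in } \mathbb{R}^2\setminus\{0\}.$$ Then $u$ is radially symmetric, and either $u\equiv 0$ in $\mathbb{R}^2$, or there exist $a\in\mathbb{R}$ and a choice of sign such that $$u(x)=\pm\frac{a^2-|x|^2}{a^2+|x|^2}\quad\text{in }\mathbb{R}^2 .$$
   Context: No symmetry of $u$ is assumed. When $a=0$, the expression $\frac{a^2-|x|^2}{a^2+|x|^2}$ is read as the constant function $-1$ on all of $\mathbb{R}^2$ (including $x=0$). *)

(* Defs.v *)
From Stdlib Require Import Reals.
From Coquelicot Require Import Coquelicot.

Open Scope R_scope.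

(* The plane is represented by pairs of real arguments, following the
   convention of Coquelicot's [Derive_2d] library. *)

Definition enorm (x y : R) : R := sqrt (x ^ 2 + y ^ 2).

(* [ex_diff_n u 2 x y] states that all iterated partial derivatives of [u] up
   to order 2 exist and are continuous at [(x, y)]; required at every point of
   an open set, this is the class C^2 on that set. *)
Definition C2_punctured_plane (u : R -> R -> R) : Prop :=
  forall x y : R, (x, y) <> (0, 0) -> ex_diff_n u 2 x y.

Definition continuous_plane (u : R -> R -> R) : Prop :=
  forall x y : R, continuity_2d_pt u x y.

Definition bounded_plane (u : R -> R -> R) : Prop :=
  exists M : R, forall x y : R, Rabs (u x y) <= M.

(* [partial_derive m k] differentiates [m] times in the first variable and
   [k] times in the second one. *)
Definition laplacian (u : R -> R -> R) (x y : R) : R :=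
  partial_derive 2 0 u x y + partial_derive 0 2 u x y.

Definition radially_symmetric (u : R -> R -> R) : Prop :=
  forall x1 y1 x2 y2 : R, enorm x1 y1 = enorm x2 y2 -> u x1 y1 = u x2 y2.

(* For [a = 0] the quotient is -1 away from the origin and 0/0 at the origin;
   it is read as the constant -1 on the whole plane. *)
Definition profile (a x y : R) : R :=
  if Req_EM_T a 0 then -1
  else (a ^ 2 - enorm x y ^ 2) / (a ^ 2 + enorm x y ^ 2).

(* Main.v *)
Require Import Defs.
From Stdlib Require Import Reals Lra List Classical ClassicalEpsilon.
From Coquelicot Require Import Coquelicot.
Open Scope R_scope.

(* In logarithmic polar coordinates, v(t, s) = u(e^t cos s, e^t sin s) is a bounded
   solution of the Allen-Cahn equation v_tt + v_ss = -2 v (1 - v^2), 2 pi-periodic in s,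
   converging uniformly to c = u(0) as t -> -oo.  The maximum principle gives |v| <= 1.

   Let I denote integration over one period in s.  The quantity
   H = I(v_t^2 - v_s^2 - (1 - v^2)^2) does not depend on t; second differences of
   I((v - c)^2) and of I(v) near t = -oo provide times at which the gradient is small in
   mean square, whence H = -2 pi (1 - c^2)^2 and c (1 - c^2) = 0.

   If c = 0, then H = -2 pi turns the second derivative of I(v^2) into
   I(4 v_t^2 + 2 v^4) >= 0; a bounded convex function on the line is constant, so v = 0.

   If c = 1 or c = -1, then H = 0, and Modica's inequality v_t^2 <= (1 - v^2)^2 forces
   v_s = 0 and v_t^2 = (1 - v^2)^2 everywhere, which leaves the explicit profiles.
   Modica's inequality says that artanh v is 1-Lipschitz.  It is proved by a two-point
   maximum principle for w(x) - w(y) - |x - y|, where w is a regularised artanh v: at a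
   positive maximum both gradients equal the same unit vector, and translating x and y
   together compares the two Laplacians.  This needs no derivative of order three. *)

(** * Maxima on boxes and of coercive functions *)

Lemma list_max_exists (T : Type) (g : T -> R) (l : list T) :
  l <> nil -> exists m, In m l /\ forall t, In t l -> g t <= g m.
Proof.
  induction l as [|a l IH]; intros Hl; [now contradiction Hl|].
  destruct l as [|b l].
  - exists a; split; [now left|]. intros t [<-|[]]; apply Rle_refl.
  - destruct IH as [m [Hm Hmax]]; [discriminate|].
    destruct (Rle_dec (g a) (g m)) as [H|H].
    + exists m; split; [now right|]. intros t [<-|Ht]; [exact H|now apply Hmax].
    + exists a; split; [now left|]. intros t [<-|Ht]; [apply Rle_refl|].
      apply Rle_trans with (g m); [now apply Hmax|lra].
Qed.

(** Without a maximum, every point of the box has a strictly better point [q] and a neighbourhood on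
    which [f] stays below [f q]. Finitely many of these neighbourhoods cover the box, and the best
    of the finitely many [q] lies in one of them, which is absurd. *)
Lemma box_max (n : nat) (f : Compactness.Tn n R -> R) (a b x0 : Compactness.Tn n R) :
  bounded_n n a b x0 ->
  (forall x eps, 0 < eps ->
     exists d : posreal, forall y, close_n n d y x -> Rabs (f y - f x) < eps) ->
  exists m, bounded_n n a b m /\ forall y, bounded_n n a b y -> f y <= f m.
Proof.
  intros H0 Hf.
  apply NNPP; intros Hno.
  assert (Hbig : forall x, bounded_n n a b x -> exists y, bounded_n n a b y /\ f x < f y).
  { intros x Hx. apply NNPP; intros Hc. apply Hno. exists x; split; [exact Hx|].
    intros y Hy. destruct (Rle_dec (f y) (f x)) as [H|H]; [exact H|].
    exfalso; apply Hc; exists y; split; [exact Hy|lra]. }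
  assert (Hd : forall x, exists p : posreal * Compactness.Tn n R, bounded_n n a b x ->
     bounded_n n a b (snd p) /\ forall y, close_n n (fst p) y x -> f y < f (snd p)).
  { intros x. destruct (classic (bounded_n n a b x)) as [Hx|Hx].
    - destruct (Hbig x Hx) as [q [Hq Hlt]].
      destruct (Hf x (f q - f x)) as [d Hd]; [lra|].
      exists (d, q); intros _; split; [exact Hq|]. intros y Hy; simpl.
      specialize (Hd y Hy). apply Rabs_def2 in Hd. lra.
    (* Outside the box the claim is vacuous; the radius 1 and [x] itself are dummy values. *)
    - exists (mkposreal 1 Rlt_0_1, x); intros H; contradiction. }
  pose (g := fun x => proj1_sig (constructive_indefinite_description _ (Hd x))).
  assert (Hg : forall x, bounded_n n a b x -> bounded_n n a b (snd (g x)) /\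
     forall y, close_n n (fst (g x)) y x -> f y < f (snd (g x))).
  { intros x; exact (proj2_sig (constructive_indefinite_description _ (Hd x))). }
  apply (compactness_list n a b (fun x => fst (g x))).
  intros [l Hl].
  (* Centres outside the box carry only dummy values, so they are discarded from the list. *)
  pose (l' := filter (fun t => if excluded_middle_informative (bounded_n n a b t)
                               then true else false) l).
  assert (Hl' : forall t, In t l' <-> In t l /\ bounded_n n a b t).
  { intros t; unfold l'; rewrite filter_In.
    destruct (excluded_middle_informative (bounded_n n a b t)); intuition discriminate. }
  destruct (Hl x0 H0) as [t1 [Ht1 [Hb1 _]]].
  destruct (list_max_exists _ (fun t => f (snd (g t))) l') as [m [Hm Hmax]].
  { intros E. assert (In t1 l') by (apply Hl'; auto). rewrite E in H; destruct H. }
  apply Hl' in Hm; destruct Hm as [Hm Hbm].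
  destruct (Hg m Hbm) as [Hq _].
  destruct (Hl _ Hq) as [t [Ht [Hbt Hct]]].
  destruct (Hg t Hbt) as [_ Hlt].
  specialize (Hlt _ Hct).
  specialize (Hmax t (proj2 (Hl' t) (conj Ht Hbt))).
  simpl in Hmax. lra.
Qed.

Lemma box4_max (f : R * (R * (R * R)) -> R) (K : R) :
  0 <= K -> (forall p, continuous f p) ->
  exists a b c d, Rabs a <= K /\ Rabs b <= K /\ Rabs c <= K /\ Rabs d <= K /\
    forall a' b' c' d', Rabs a' <= K -> Rabs b' <= K -> Rabs c' <= K -> Rabs d' <= K ->
      f (a', (b', (c', d'))) <= f (a, (b, (c, d))).
Proof.
  intros HK Hf.
  destruct (box_max 4 (fun x => let '(a, (b, (c, (d, _)))) := x in f (a, (b, (c, d))))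
    (- K, (- K, (- K, (- K, tt)))) (K, (K, (K, (K, tt)))) (0, (0, (0, (0, tt)))))
    as [[a [b [c [d []]]]] [Hb Hmax]].
  - simpl; repeat split; lra.
  - intros [a [b [c [d []]]]] eps Heps.
    destruct (proj1 (filterlim_locally (F := locally (a, (b, (c, d)))) f
       (f (a, (b, (c, d))))) (Hf (a, (b, (c, d)))) (mkposreal eps Heps)) as [del Hdel].
    exists del. intros [a' [b' [c' [d' []]]]]; simpl; intros (H1 & H2 & H3 & H4 & _).
    apply (Hdel (a', (b', (c', d')))). repeat split; assumption.
  - exists a, b, c, d. simpl in Hb.
    repeat split; try (apply Rabs_le; lra).
    intros a' b' c' d' Ha Hb' Hc Hd.
    apply (Hmax (a', (b', (c', (d', tt))))).
    apply Rabs_le_between in Ha, Hb', Hc, Hd. simpl; repeat split; lra.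
Qed.

Lemma max_derive_zero (f : R -> R) (x l : R) :
  (forall z, f z <= f x) -> is_derive f x l -> l = 0.
Proof.
  intros Hmax Hd.
  apply is_derive_Reals in Hd.
  pose (pr := exist _ l Hd : derivable_pt f x).
  change l with (derive_pt f x pr).
  apply deriv_maximum with (a := x - 1) (b := x + 1); try lra.
  intros; apply Hmax.
Qed.

(** If [l] were positive, [f'], which vanishes at [x], would be positive just to the right of [x],
    and the mean value theorem would give a larger value of [f] there. *)
Lemma max_second_derive_nonpos (f f' : R -> R) (x l : R) :
  (forall z, f z <= f x) -> (forall z, is_derive f z (f' z)) -> is_derive f' x l -> l <= 0.
Proof.
  intros Hmax Hd Hd2.
  destruct (Rle_dec l 0) as [H|H]; [exact H|exfalso].
  assert (H0 : f' x = 0) by (eapply max_derive_zero; eauto).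
  assert (Hl : 0 < l) by lra.
  apply is_derive_Reals in Hd2.
  destruct (Hd2 l Hl) as [d Hdd].
  assert (Hdp := cond_pos d).
  destruct (MVT_cor2 f f' x (x + d / 2)) as [c [Heq Hc]]; [lra| |].
  { intros z _. apply is_derive_Reals, Hd. }
  specialize (Hdd (c - x) ltac:(intro; lra)).
  replace (x + (c - x)) with c in Hdd by ring.
  rewrite H0, Rminus_0_r in Hdd.
  rewrite (Rabs_right (c - x)) in Hdd by lra.
  specialize (Hdd ltac:(lra)). apply Rabs_def2 in Hdd.
  assert (0 < f' c).
  { replace (f' c) with (f' c / (c - x) * (c - x)) by (field; lra).
    apply Rmult_lt_0_compat; lra. }
  assert (0 < f' c * (x + d / 2 - x)) by (apply Rmult_lt_0_compat; lra).
  specialize (Hmax (x + d / 2)). lra.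
Qed.

(* [ring] does not see through Coquelicot's structures on [R]. *)
Ltac R_ring := match goal with |- @eq _ ?a ?b => change (@eq R a b) end; ring.

(** The reference point beats everything outside the box of half-side [K], so it lies in the box and
    the maximum over the box is global. *)
Lemma coercive_max4 (f : R * (R * (R * R)) -> R) (K a0 b0 c0 d0 : R) :
  (forall p, continuous f p) ->
  (forall a b c d, K < Rabs a \/ K < Rabs b \/ K < Rabs c \/ K < Rabs d ->
     f (a, (b, (c, d))) < f (a0, (b0, (c0, d0)))) ->
  exists a b c d, forall a' b' c' d', f (a', (b', (c', d'))) <= f (a, (b, (c, d))).
Proof.
  intros Hf Hout.
  assert (Hin : forall a b c d, f (a0, (b0, (c0, d0))) <= f (a, (b, (c, d))) ->
      Rabs a <= K /\ Rabs b <= K /\ Rabs c <= K /\ Rabs d <= K).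
  { intros a b c d Hle.
    repeat split; apply Rnot_lt_le; intros Hc;
      (assert (Hlt : f (a, (b, (c, d))) < f (a0, (b0, (c0, d0)))) by (apply Hout; tauto)); lra. }
  destruct (Hin _ _ _ _ (Rle_refl _)) as (Ha & Hb & Hc & Hd).
  destruct (box4_max f K) as (a & b & c & d & _ & _ & _ & _ & Hmax).
  - generalize (Rabs_pos a0); lra.
  - exact Hf.
  - exists a, b, c, d. intros a' b' c' d'.
    destruct (Rle_dec (f (a0, (b0, (c0, d0)))) (f (a', (b', (c', d'))))) as [H|H].
    + destruct (Hin _ _ _ _ H) as (? & ? & ? & ?). now apply Hmax.
    + apply Rle_trans with (f (a0, (b0, (c0, d0)))); [lra|]. now apply Hmax.
Qed.

Lemma coercive_max2 (f : R -> R -> R) (K a0 b0 : R) :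
  (forall a b, continuity_2d_pt f a b) ->
  (forall a b, K < Rabs a \/ K < Rabs b -> f a b < f a0 b0) ->
  exists a b, forall a' b', f a' b' <= f a b.
Proof.
  intros Hf Hout.
  assert (Hin : forall a b, f a0 b0 <= f a b -> Rabs a <= K /\ Rabs b <= K).
  { intros a b Hle.
    split; apply Rnot_lt_le; intros Hc;
      (assert (Hlt : f a b < f a0 b0) by (apply Hout; tauto)); lra. }
  destruct (Hin _ _ (Rle_refl _)) as (Ha & Hb).
  assert (HK : 0 <= K) by (generalize (Rabs_pos a0); lra).
  (* [f] is viewed as a function of four variables that ignores the last two. *)
  destruct (box4_max (fun p => f (fst p) (fst (snd p))) K HK)
    as (a & b & c & d & _ & _ & _ & _ & Hmax).
  - intros [a [b q]].
    apply (continuous_comp_2 (fun p : R * (R * (R * R)) => fst p) (fun p => fst (snd p)) f).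
    + apply continuous_fst.
    + apply (continuous_comp (fun p : R * (R * (R * R)) => snd p) fst);
        [apply continuous_snd | apply continuous_fst].
    + apply continuity_2d_pt_filterlim, Hf.
  - exists a, b. intros a' b'.
    assert (H0 : Rabs 0 <= K) by (rewrite Rabs_R0; exact HK).
    destruct (Rle_dec (f a0 b0) (f a' b')) as [H|H].
    + destruct (Hin _ _ H). now apply (Hmax a' b' 0 0).
    + apply Rle_trans with (f a0 b0); [lra|]. now apply (Hmax a0 b0 0 0).
Qed.

(** * Bounded solutions of the Allen-Cahn equation in the plane *)

(** Carrying the partial derivatives as named functions avoids [Derive] in later computations. The
    single [vts] for both mixed derivatives builds in their symmetry. *)
Record C2_jet (v vt vs vtt vts vss : R -> R -> R) : Prop := {
  jet_t : forall t s, is_derive (fun z => v z s) t (vt t s);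
  jet_s : forall t s, is_derive (fun z => v t z) s (vs t s);
  jet_tt : forall t s, is_derive (fun z => vt z s) t (vtt t s);
  jet_ts : forall t s, is_derive (fun z => vt t z) s (vts t s);
  jet_st : forall t s, is_derive (fun z => vs z s) t (vts t s);
  jet_ss : forall t s, is_derive (fun z => vs t z) s (vss t s);
  jet_c : forall t s, continuity_2d_pt v t s;
  jet_ct : forall t s, continuity_2d_pt vt t s;
  jet_cs : forall t s, continuity_2d_pt vs t s;
  jet_ctt : forall t s, continuity_2d_pt vtt t s;
  jet_cts : forall t s, continuity_2d_pt vts t s;
  jet_css : forall t s, continuity_2d_pt vss t s }.

Definition allen_cahn (v vtt vss : R -> R -> R) : Prop :=
  forall t s, vtt t s + vss t s = - 2 * v t s * (1 - v t s ^ 2).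

Lemma C2_jet_opp v vt vs vtt vts vss :
  C2_jet v vt vs vtt vts vss ->
  C2_jet (fun t s => - v t s) (fun t s => - vt t s) (fun t s => - vs t s)
    (fun t s => - vtt t s) (fun t s => - vts t s) (fun t s => - vss t s).
Proof.
  intros [H1 H2 H3 H4 H5 H6 H7 H8 H9 H10 H11 H12].
  split; intros t s;
    try (apply continuity_2d_pt_opp; auto);
    match goal with |- is_derive (fun z => - @?f z) _ _ =>
      apply (is_derive_opp f); auto end.
Qed.

Lemma allen_cahn_opp v vtt vss :
  allen_cahn v vtt vss ->
  allen_cahn (fun t s => - v t s) (fun t s => - vtt t s) (fun t s => - vss t s).
Proof. intros H t s. specialize (H t s). simpl in *. lra. Qed.

Lemma exists_small_pos (m K : R) :
  0 < m -> 0 <= K -> exists e, 0 < e <= 1 /\ e * K < m.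
Proof.
  intros Hm HK.
  exists (Rmin 1 (m / (K + 1))).
  assert (Hp : 0 < m / (K + 1)) by (apply Rdiv_lt_0_compat; lra).
  assert (Hs : 0 < Rmin 1 (m / (K + 1))) by (apply Rmin_glb_lt; lra).
  split; [split; [exact Hs | apply Rmin_l]|].
  apply Rle_lt_trans with (m / (K + 1) * K).
  - apply Rmult_le_compat_r; [exact HK | apply Rmin_r].
  - replace m with (m / (K + 1) * (K + 1)) at 2 by (field; lra).
    apply Rmult_lt_compat_l; lra.
Qed.

Lemma is_derive_sub_square (f : R -> R) (x l e c : R) :
  is_derive f x l -> is_derive (fun z => f z - e * (z ^ 2 + c)) x (l - 2 * e * x).
Proof.
  intros Hf.
  apply (is_derive_minus f (fun z => e * (z ^ 2 + c))); [exact Hf|].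
  auto_derive; [exact I | ring].
Qed.

Lemma sq_lt_abs (K a : R) : 0 <= K -> K < Rabs a -> K * K < a ^ 2.
Proof.
  intros HK Ha. replace (a ^ 2) with (Rabs a * Rabs a).
  - apply Rmult_le_0_lt_compat; lra.
  - rewrite <- Rabs_mult, Rabs_right; [ring|]. generalize (Rle_0_sqr a); unfold Rsqr; lra.
Qed.

Lemma continuity_2d_sq (e a b : R) : continuity_2d_pt (fun t s => e * (t ^ 2 + s ^ 2)) a b.
Proof.
  apply continuity_2d_pt_mult; [apply continuity_2d_pt_const|].
  apply continuity_2d_pt_plus;
    apply (continuity_1d_2d_pt_comp (fun z => z ^ 2)); try reg;
    [apply continuity_2d_pt_id1 | apply continuity_2d_pt_id2].
Qed.

(** Let [m] be the excess of [v] over 1 at some point. The penalised function [v - e (t^2 + s^2)]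
    attains its maximum at a point where the Laplacian of [v] is at most [4 e < 2 m]. There
    [v > 1 + m / 2], so the equation makes the Laplacian [2 v (v^2 - 1)] exceed [2 m]. *)
Lemma bounded_solution_le_1 v vt vs vtt vts vss M :
  C2_jet v vt vs vtt vts vss -> allen_cahn v vtt vss ->
  (forall t s, Rabs (v t s) <= M) ->
  forall t s, v t s <= 1.
Proof.
  intros J E HM t0 s0.
  apply Rnot_lt_le; intros Hlt.
  assert (HM0 : 0 <= M) by (generalize (HM 0 0) (Rabs_pos (v 0 0)); lra).
  set (m := v t0 s0 - 1).
  assert (Hm : 0 < m) by (unfold m; lra).
  destruct (exists_small_pos (m / 2) (1 + t0 ^ 2 + s0 ^ 2)) as [e [He Hem]]; [lra|nra|].
  assert (He2 : e * (t0 ^ 2 + s0 ^ 2) >= 0) by (apply Rle_ge, Rmult_le_pos; nra).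
  set (f := fun t s => v t s - e * (t ^ 2 + s ^ 2)).
  (* Adding 1 ensures [K * K >= (2 * M + 1) / e], so beyond [K] the penalty outweighs the bound
     [M]. *)
  set (K := (2 * M + 1) / e + 1).
  assert (HK1 : 0 < (2 * M + 1) / e) by (apply Rdiv_lt_0_compat; lra).
  assert (HK : e * (K * K) > M).
  { apply Rlt_le_trans with (e * ((2 * M + 1) / e)).
    - replace (e * ((2 * M + 1) / e)) with (2 * M + 1) by (field; lra). lra.
    - apply Rmult_le_compat_l; [lra|]. unfold K; nra. }
  assert (Hf0 : f t0 s0 > 1 + m / 2) by (unfold f, m in *; lra).
  destruct (coercive_max2 f K t0 s0) as [a [b Hmax]].
  - intros a b. apply continuity_2d_pt_minus; [apply (jet_c _ _ _ _ _ _ J)|].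
    apply continuity_2d_sq.
  - intros a b Hab. unfold f at 1.
    assert (Hv := Rle_abs (v a b)). specialize (HM a b).
    assert (K * K < a ^ 2 + b ^ 2).
    { destruct Hab as [H|H]; apply sq_lt_abs in H; unfold K in *; nra. }
    assert (e * (K * K) < e * (a ^ 2 + b ^ 2)) by (apply Rmult_lt_compat_l; lra).
    lra.
  - assert (H1 : vtt a b - 2 * e <= 0).
    { apply (max_second_derive_nonpos (fun z => f z b) (fun z => vt z b - 2 * e * z) a).
      - intros z; apply Hmax.
      - intros z. apply (is_derive_sub_square (fun z => v z b)), (jet_t _ _ _ _ _ _ J).
      - apply (is_derive_minus (fun z => vt z b) (fun z => 2 * e * z)).
        + apply (jet_tt _ _ _ _ _ _ J).
        + auto_derive; [exact I | ring]. }
    assert (H2 : vss a b - 2 * e <= 0).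
    { apply (max_second_derive_nonpos (fun z => f a z) (fun z => vs a z - 2 * e * z) b).
      - intros z; apply Hmax.
      - intros z. apply is_derive_ext with (fun z => v a z - e * (z ^ 2 + a ^ 2)).
        + intros y; unfold f; R_ring.
        + apply (is_derive_sub_square (fun z => v a z)), (jet_s _ _ _ _ _ _ J).
      - apply (is_derive_minus (fun z => vs a z) (fun z => 2 * e * z)).
        + apply (jet_ss _ _ _ _ _ _ J).
        + auto_derive; [exact I | ring]. }
    assert (Hv : v a b > 1 + m / 2).
    { specialize (Hmax t0 s0).
      assert (f a b <= v a b).
      { unfold f. assert (0 <= e * (a ^ 2 + b ^ 2)) by (apply Rmult_le_pos; nra). lra. }
      lra. }
    specialize (E a b).
    assert (Hem' : e < m / 2) by nra.
    assert (m < v a b ^ 2 - 1) by nra.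
    assert (m < v a b * (v a b ^ 2 - 1)) by nra.
    nra.
Qed.

Lemma bounded_solution_abs_le_1 v vt vs vtt vts vss M :
  C2_jet v vt vs vtt vts vss -> allen_cahn v vtt vss ->
  (forall t s, Rabs (v t s) <= M) ->
  forall t s, -1 <= v t s <= 1.
Proof.
  intros J E HM t s. split.
  - assert (H := bounded_solution_le_1 _ _ _ _ _ _ M (C2_jet_opp _ _ _ _ _ _ J)
      (allen_cahn_opp _ _ _ E)).
    simpl in H. specialize (H ltac:(intros; rewrite Rabs_Ropp; apply HM) t s). lra.
  - eapply bounded_solution_le_1; eauto.
Qed.

(** * The two-point maximum principle and Modica's inequality *)

Lemma sqrt_sq_ge_abs_l (x y : R) : Rabs x <= sqrt (x ^ 2 + y ^ 2).
Proof.
  rewrite <- sqrt_Rsqr_abs. apply sqrt_le_1_alt. unfold Rsqr. nra.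
Qed.

Lemma sqrt_sq_ge_abs_r (x y : R) : Rabs y <= sqrt (x ^ 2 + y ^ 2).
Proof. rewrite Rplus_comm. apply sqrt_sq_ge_abs_l. Qed.

Lemma two_point_continuous (w : R -> R -> R) (e : R) (p : R * (R * (R * R))) :
  (forall t s, continuity_2d_pt w t s) ->
  continuous (fun p : R * (R * (R * R)) => let '(a, (b, (c, d))) := p in
     w a b - w c d - sqrt ((a - c) ^ 2 + (b - d) ^ 2) - e * (a ^ 2 + b ^ 2)) p.
Proof.
  intros Hw.
  apply continuous_ext with (fun p : R * (R * (R * R)) =>
    w (fst p) (fst (snd p)) - w (fst (snd (snd p))) (snd (snd (snd p)))
    - sqrt ((fst p - fst (snd (snd p))) ^ 2 + (fst (snd p) - snd (snd (snd p))) ^ 2)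
    - e * (fst p ^ 2 + fst (snd p) ^ 2)).
  { intros [a [b [c d]]]; reflexivity. }
  assert (C1 : continuous (fun p : R * (R * (R * R)) => fst p) p) by apply continuous_fst.
  assert (C2 : continuous (fun p : R * (R * (R * R)) => fst (snd p)) p).
  { apply (continuous_comp (fun p : R * (R * (R * R)) => snd p) fst);
      [apply continuous_snd | apply continuous_fst]. }
  assert (C34 : continuous (fun p : R * (R * (R * R)) => snd (snd p)) p).
  { apply (continuous_comp (fun p : R * (R * (R * R)) => snd p) snd);
      apply continuous_snd. }
  assert (C3 : continuous (fun p : R * (R * (R * R)) => fst (snd (snd p))) p).
  { apply (continuous_comp (fun p : R * (R * (R * R)) => snd (snd p)) fst);
      [exact C34 | apply continuous_fst]. }
  assert (C4 : continuous (fun p : R * (R * (R * R)) => snd (snd (snd p))) p).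
  { apply (continuous_comp (fun p : R * (R * (R * R)) => snd (snd p)) snd);
      [exact C34 | apply continuous_snd]. }
  assert (Csq : forall f : R * (R * (R * R)) -> R, continuous f p ->
                continuous (fun q => f q ^ 2) p).
  { intros f Hf. apply (continuous_comp f (fun z => z ^ 2)); [exact Hf|].
    apply (ex_derive_continuous (fun z : R => z ^ 2)). auto_derive; exact I. }
  apply (continuous_minus (V := R_NormedModule)); [apply (continuous_minus (V := R_NormedModule));
    [apply (continuous_minus (V := R_NormedModule))|]|].
  - apply (continuous_comp_2 (fun p : R * (R * (R * R)) => fst p) (fun p => fst (snd p)) w);
      auto. apply continuity_2d_pt_filterlim, Hw.
  - apply (continuous_comp_2 (fun p : R * (R * (R * R)) => fst (snd (snd p)))
      (fun p => snd (snd (snd p))) w); auto. apply continuity_2d_pt_filterlim, Hw.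
  - apply (continuous_comp (fun p : R * (R * (R * R)) =>
      (fst p - fst (snd (snd p))) ^ 2 + (fst (snd p) - snd (snd (snd p))) ^ 2) sqrt).
    + apply (continuous_plus (V := R_NormedModule)); apply Csq;
        apply (continuous_minus (V := R_NormedModule)); auto.
    + apply continuous_sqrt.
  - apply (continuous_scal_r (V := R_NormedModule) e).
    apply (continuous_plus (V := R_NormedModule)); apply Csq; auto.
Qed.

Lemma is_derive_dist (s s' t' x : R) :
  0 < sqrt ((x - t') ^ 2 + (s - s') ^ 2) ->
  is_derive (fun z => sqrt ((z - t') ^ 2 + (s - s') ^ 2)) x
    ((x - t') / sqrt ((x - t') ^ 2 + (s - s') ^ 2)).
Proof.
  intros H.
  assert (0 < (x - t') ^ 2 + (s - s') ^ 2).
  { apply Rnot_le_lt; intros Hle. rewrite sqrt_neg_0 in H by exact Hle. lra. }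
  auto_derive.
  - repeat split. lra.
  - unfold Rminus, Rdiv in *. simpl in *. field. lra.
Qed.

(* [phi] need only grow at least as fast as [w] as a function of [v]; the positive constant
   [k] is what makes the comparison of the two Laplacians strict. *)
Lemma two_point_estimate (w wt ws wtt wss v : R -> R -> R) (phi : R -> R) (B k : R) :
  (forall t s, is_derive (fun z => w z s) t (wt t s)) ->
  (forall t s, is_derive (fun z => w t z) s (ws t s)) ->
  (forall t s, is_derive (fun z => wt z s) t (wtt t s)) ->
  (forall t s, is_derive (fun z => ws t z) s (wss t s)) ->
  (forall t s, continuity_2d_pt w t s) ->
  (forall t s, Rabs (w t s) <= B) ->
  (forall t s, -1 <= v t s <= 1) ->
  0 < k ->
  (forall t s, wtt t s + wss t s
     = 2 * v t s * (wt t s ^ 2 + ws t s ^ 2 - 1) + k * phi (v t s)) ->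
  (forall t s t' s', w t' s' <= w t s ->
     w t s - w t' s' <= phi (v t s) - phi (v t' s')) ->
  forall t s t' s', w t s - w t' s' <= sqrt ((t - t') ^ 2 + (s - s') ^ 2).
Proof.
  intros Dt Ds Dtt Dss Cw HB Hv Hk Eq Hphi t0 s0 t1 s1.
  apply Rnot_lt_le; intros Hlt.
  assert (HB0 : 0 <= B) by (generalize (HB 0 0) (Rabs_pos (w 0 0)); lra).
  assert (Hsq : forall x y : R, 0 <= x ^ 2 + y ^ 2) by (intros; nra).
  set (m := w t0 s0 - w t1 s1 - sqrt ((t0 - t1) ^ 2 + (s0 - s1) ^ 2)).
  assert (Hm : 0 < m) by (unfold m; lra).
  (* [e1] keeps the penalised value at the reference points above [m / 2]; [e2] makes
     [e * (8 + 24 * B)], the total error in the final comparison of Laplacians, smaller than the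
     gain [k * (m / 2)]. *)
  destruct (exists_small_pos (m / 2) (t0 ^ 2 + s0 ^ 2)) as [e1 [He1 Hem1]]; [lra|nra|].
  destruct (exists_small_pos (k * (m / 2)) (8 + 24 * B)) as [e2 [He2 Hem2]]; [nra|lra|].
  set (e := Rmin e1 e2).
  assert (He : 0 < e <= 1).
  { unfold e; split; [apply Rmin_glb_lt; lra|]. apply Rle_trans with e1; [apply Rmin_l|lra]. }
  assert (Hee1 : e * e * (t0 ^ 2 + s0 ^ 2) < m / 2).
  { apply Rle_lt_trans with (e1 * (t0 ^ 2 + s0 ^ 2)); [|exact Hem1].
    apply Rmult_le_compat_r; [nra|]. assert (e <= e1) by apply Rmin_l. nra. }
  assert (Hee2 : e * (8 + 24 * B) < k * (m / 2)).
  { apply Rle_lt_trans with (e2 * (8 + 24 * B)); [|exact Hem2].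
    apply Rmult_le_compat_r; [lra|apply Rmin_r]. }
  clearbody e. clear e1 He1 Hem1 e2 He2 Hem2.
  (* Only the first point is penalised; the distance term keeps the second one near it. At the
     maximum [e * e * (a ^ 2 + b ^ 2) <= 2 * B], so with the weight [e * e] the gradient of the
     penalty is of order [e]. *)
  set (f := fun p : R * (R * (R * R)) => let '(a, (b, (c, d))) := p in
     w a b - w c d - sqrt ((a - c) ^ 2 + (b - d) ^ 2) - e * e * (a ^ 2 + b ^ 2)).
  assert (Hf0 : m / 2 < f (t0, (s0, (t1, s1)))) by (unfold f, m in *; lra).
  set (K0 := (2 * B + 1) / (e * e) + 1).
  assert (Hq : 0 < (2 * B + 1) / (e * e)) by (apply Rdiv_lt_0_compat; nra).
  assert (HK0 : 2 * B < e * e * (K0 * K0)).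
  { apply Rlt_le_trans with (e * e * ((2 * B + 1) / (e * e))).
    - replace (e * e * ((2 * B + 1) / (e * e))) with (2 * B + 1) by (field; lra). lra.
    - apply Rmult_le_compat_l; [nra|]. unfold K0; nra. }
  assert (HK00 : 0 <= K0) by (unfold K0; lra).
  clearbody K0. clear Hq.
  assert (Hww : forall a b c d, w a b - w c d <= 2 * B).
  { intros a b c d. assert (H1 := HB a b). assert (H2 := HB c d).
    apply Rabs_le_between in H1, H2. lra. }
  assert (Hfar : forall a b c d, K0 < Rabs a \/ K0 < Rabs b -> f (a, (b, (c, d))) < 0).
  { intros a b c d H. unfold f.
    assert (K0 * K0 < a ^ 2 + b ^ 2) by (destruct H as [H|H]; apply sq_lt_abs in H; nra).
    assert (e * e * (K0 * K0) < e * e * (a ^ 2 + b ^ 2)) by (apply Rmult_lt_compat_l; nra).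
    assert (Hs := sqrt_pos ((a - c) ^ 2 + (b - d) ^ 2)).
    specialize (Hww a b c d). lra. }
  (* Differences of [w] are at most [2 * B], so a larger distance makes [f] negative. Together with
     [Hfar] this confines the maximum to the box of half-side [K0 + 2 * B]. *)
  assert (Hfar2 : forall a b c d, 2 * B < Rabs (a - c) \/ 2 * B < Rabs (b - d) ->
    f (a, (b, (c, d))) < 0).
  { intros a b c d H. unfold f.
    assert (Hs1 := sqrt_sq_ge_abs_l (a - c) (b - d)).
    assert (Hs2 := sqrt_sq_ge_abs_r (a - c) (b - d)).
    assert (0 <= e * e * (a ^ 2 + b ^ 2)) by (apply Rmult_le_pos; [nra|apply Hsq]).
    specialize (Hww a b c d). destruct H; lra. }
  destruct (coercive_max4 f (K0 + 2 * B) t0 s0 t1 s1) as (a & b & c & d & Hmax).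
  { intros p. apply two_point_continuous, Cw. }
  { intros a b c d H. apply Rlt_trans with 0; [|lra].
    destruct (Rlt_dec K0 (Rabs a)) as [Ha|Ha]; [apply Hfar; tauto|].
    destruct (Rlt_dec K0 (Rabs b)) as [Hb|Hb]; [apply Hfar; tauto|].
    apply Hfar2.
    destruct H as [H|[H|[H|H]]]; try lra.
    - left. assert (Ht := Rabs_triang_inv c a). rewrite Rabs_minus_sym. lra.
    - right. assert (Ht := Rabs_triang_inv d b). rewrite Rabs_minus_sym. lra. }
  assert (Hpos := Hmax t0 s0 t1 s1).
  set (D := sqrt ((a - c) ^ 2 + (b - d) ^ 2)).
  assert (HD0 : 0 <= D) by apply sqrt_pos.
  assert (Hpen : 0 <= e * e * (a ^ 2 + b ^ 2)) by (apply Rmult_le_pos; [nra|apply Hsq]).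
  assert (Hfm : m / 2 < w a b - w c d - D - e * e * (a ^ 2 + b ^ 2)).
  { change (m / 2 < f (a, (b, (c, d)))). lra. }
  (* At coinciding points [f] is at most 0, so at the maximum the distance is positive and hence
     differentiable. *)
  assert (HDp : 0 < D).
  { destruct (Rle_lt_or_eq_dec _ _ HD0) as [H|H]; [exact H|exfalso].
    assert (Hs1 := sqrt_sq_ge_abs_l (a - c) (b - d)).
    assert (Hs2 := sqrt_sq_ge_abs_r (a - c) (b - d)). fold D in Hs1, Hs2.
    rewrite <- H in Hs1, Hs2.
    apply Rabs_le_between in Hs1, Hs2.
    replace c with a in Hfm by lra. replace d with b in Hfm by lra. lra. }
  assert (HD2 : D * D = (a - c) ^ 2 + (b - d) ^ 2) by apply sqrt_sqrt, Hsq.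
  (* First-order conditions in the four variables: with [(p, q)] the unit vector from [(c, d)] to
     [(a, b)], the gradient of [w] is [(p, q)] at [(c, d)], and [(p, q)] plus the gradient of the
     penalty at [(a, b)]. *)
  assert (Gt : wt a b - (a - c) / D - 2 * (e * e) * a = 0).
  { apply (max_derive_zero (fun z => f (z, (b, (c, d)))) a); [intros z; apply Hmax|].
    apply is_derive_ext with
      (fun z => w z b - w c d - sqrt ((z - c) ^ 2 + (b - d) ^ 2) - e * e * (z ^ 2 + b ^ 2)).
    { reflexivity. }
    apply is_derive_sub_square.
    apply (is_derive_minus (fun z => w z b - w c d)).
    - replace (wt a b) with (wt a b - 0) by ring.
      apply (is_derive_minus (fun z => w z b) (fun _ => w c d)); [apply Dt|apply (is_derive_const (V := R_NormedModule))].
    - apply is_derive_dist, HDp. }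
  assert (Gs : ws a b - (b - d) / D - 2 * (e * e) * b = 0).
  { apply (max_derive_zero (fun z => f (a, (z, (c, d)))) b); [intros z; apply Hmax|].
    apply is_derive_ext with
      (fun z => w a z - w c d - sqrt ((z - d) ^ 2 + (a - c) ^ 2) - e * e * (z ^ 2 + a ^ 2)).
    { intros z; unfold f. rewrite (Rplus_comm (a ^ 2)), (Rplus_comm ((z - d) ^ 2)).
      reflexivity. }
    apply is_derive_sub_square.
    apply (is_derive_minus (fun z => w a z - w c d)).
    - replace (ws a b) with (ws a b - 0) by ring.
      apply (is_derive_minus (fun z => w a z) (fun _ => w c d)); [apply Ds|apply (is_derive_const (V := R_NormedModule))].
    - unfold D. rewrite (Rplus_comm ((a - c) ^ 2)). apply is_derive_dist.
      rewrite Rplus_comm; exact HDp. }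
  assert (Gt' : 0 - wt c d - (c - a) / D = 0).
  { apply (max_derive_zero (fun z => f (a, (b, (z, d)))) c); [intros z; apply Hmax|].
    apply is_derive_ext with
      (fun z => (w a b - e * e * (a ^ 2 + b ^ 2)) - w z d - sqrt ((z - a) ^ 2 + (b - d) ^ 2)).
    { intros z; unfold f. replace ((z - a) ^ 2) with ((a - z) ^ 2) by ring. R_ring. }
    apply (is_derive_minus (fun z => (w a b - e * e * (a ^ 2 + b ^ 2)) - w z d)).
    - apply (is_derive_minus (fun z => (w a b - e * e * (a ^ 2 + b ^ 2))));
        [apply (is_derive_const (V := R_NormedModule)) | apply Dt].
    - unfold D. replace ((a - c) ^ 2) with ((c - a) ^ 2) by ring. apply is_derive_dist.
      replace ((c - a) ^ 2) with ((a - c) ^ 2) by ring. exact HDp. }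
  assert (Gs' : 0 - ws c d - (d - b) / D = 0).
  { apply (max_derive_zero (fun z => f (a, (b, (c, z)))) d); [intros z; apply Hmax|].
    apply is_derive_ext with
      (fun z => (w a b - e * e * (a ^ 2 + b ^ 2)) - w c z - sqrt ((z - b) ^ 2 + (a - c) ^ 2)).
    { intros z; unfold f. replace ((z - b) ^ 2 + (a - c) ^ 2) with
        ((a - c) ^ 2 + (b - z) ^ 2) by ring. R_ring. }
    apply (is_derive_minus (fun z => (w a b - e * e * (a ^ 2 + b ^ 2)) - w c z)).
    - apply (is_derive_minus (fun z => (w a b - e * e * (a ^ 2 + b ^ 2))));
        [apply (is_derive_const (V := R_NormedModule)) | apply Ds].
    - unfold D. replace ((a - c) ^ 2 + (b - d) ^ 2) with ((d - b) ^ 2 + (a - c) ^ 2) by ring.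
      apply is_derive_dist.
      replace ((d - b) ^ 2 + (a - c) ^ 2) with ((a - c) ^ 2 + (b - d) ^ 2) by ring.
      exact HDp. }
  assert (Hshift : forall (g : R -> R) (y l x : R), is_derive g (x + y) l ->
            is_derive (fun z => g (z + y)) x l).
  { intros g y l x Hg.
    assert (Hs : is_derive (fun z : R => z + y) x 1) by (auto_derive; [exact I|ring]).
    generalize (is_derive_comp g (fun z => z + y) x l 1 Hg Hs).
    intros H; replace l with (scal 1 l) by (apply Rmult_1_l). exact H. }
  (* Moving both points by the same vector leaves their distance unchanged, so the second-order
     condition involves only [w] at the two points and the penalty. *)
  assert (Htt : wtt a b - wtt c d - 2 * (e * e) <= 0).
  { apply (max_second_derive_nonpos (fun z => w z b - w (z + (c - a)) d - e * e * (z ^ 2 + b ^ 2))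
      (fun z => wt z b - wt (z + (c - a)) d - 2 * (e * e) * z) a).
    - intros z. assert (Hz := Hmax z b (z + (c - a)) d). unfold f in Hz.
      replace (z - (z + (c - a))) with (a - c) in Hz by ring.
      replace (a + (c - a)) with c by ring. lra.
    - intros z. apply is_derive_sub_square.
      apply (is_derive_minus (fun z => w z b) (fun z => w (z + (c - a)) d)); [apply Dt|].
      apply (Hshift (fun z => w z d)); apply Dt.
    - apply (is_derive_minus (fun z => wt z b - wt (z + (c - a)) d) (fun z => 2 * (e * e) * z)).
      + apply (is_derive_minus (fun z => wt z b) (fun z => wt (z + (c - a)) d)); [apply Dtt|].
        apply (Hshift (fun z => wt z d)).
        replace (a + (c - a)) with c by ring. apply Dtt.
      + auto_derive; [exact I | ring]. }
  assert (Hss : wss a b - wss c d - 2 * (e * e) <= 0).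
  { apply (max_second_derive_nonpos (fun z => w a z - w c (z + (d - b)) - e * e * (z ^ 2 + a ^ 2))
      (fun z => ws a z - ws c (z + (d - b)) - 2 * (e * e) * z) b).
    - intros z. assert (Hz := Hmax a z c (z + (d - b))). unfold f in Hz.
      replace (z - (z + (d - b))) with (b - d) in Hz by ring.
      replace (b + (d - b)) with d by ring. lra.
    - intros z. apply is_derive_sub_square.
      apply (is_derive_minus (fun z => w a z) (fun z => w c (z + (d - b)))); [apply Ds|].
      apply (Hshift (fun z => w c z)); apply Ds.
    - apply (is_derive_minus (fun z => ws a z - ws c (z + (d - b))) (fun z => 2 * (e * e) * z)).
      + apply (is_derive_minus (fun z => ws a z) (fun z => ws c (z + (d - b)))); [apply Dss|].
        apply (Hshift (fun z => ws c z)).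
        replace (b + (d - b)) with d by ring. apply Dss.
      + auto_derive; [exact I | ring]. }
  set (p := (a - c) / D) in *. set (q := (b - d) / D) in *.
  assert (Hunit : p ^ 2 + q ^ 2 = 1).
  { unfold p, q. replace (((a - c) / D) ^ 2 + ((b - d) / D) ^ 2)
      with (((a - c) ^ 2 + (b - d) ^ 2) / (D * D)) by (field; lra).
    rewrite <- HD2. field; lra. }
  replace ((c - a) / D) with (- p) in Gt' by (unfold p; field; lra).
  replace ((d - b) / D) with (- q) in Gs' by (unfold q; field; lra).
  assert (E1 := Eq a b). assert (E2 := Eq c d).
  replace (wt c d) with p in E2 by lra. replace (ws c d) with q in E2 by lra.
  replace (wt a b) with (p + 2 * (e * e) * a) in E1 by lra.
  replace (ws a b) with (q + 2 * (e * e) * b) in E1 by lra.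
  replace (p ^ 2 + q ^ 2 - 1) with 0 in E2 by lra.
  replace ((p + 2 * (e * e) * a) ^ 2 + (q + 2 * (e * e) * b) ^ 2 - 1)
    with (4 * (e * e) * (a * p + b * q) + 4 * (e * e) * (e * e * (a ^ 2 + b ^ 2))) in E1
    by (replace 1 with (p ^ 2 + q ^ 2) by lra; ring).
  assert (Hwd := Hww a b c d).
  (* The gap of [w] exceeds [m / 2], hence so does that of [phi]: the two Laplacians differ by at
     least [k * (m / 2)] up to terms of order [e]. *)
  assert (Hphi' := Hphi a b c d ltac:(lra)).
  assert (Hkphi : k * (m / 2) <= k * (phi (v a b) - phi (v c d))).
  { apply Rmult_le_compat_l; lra. }
  set (r := e * e * (a ^ 2 + b ^ 2)) in *.
  assert (Hr : r <= 2 * B) by lra.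
  (* A form of the Cauchy-Schwarz inequality: expand the squared norms of [(e a, e b) - (p, q)] and
     [(e a, e b) + (p, q)], and use [r <= 2 * B]. *)
  assert (Hcs : -(e * (1 + 2 * B)) <= 2 * (e * e) * (a * p + b * q) <= e * (1 + 2 * B)).
  { assert (H1 : 0 <= (e * a - p) ^ 2 + (e * b - q) ^ 2) by apply Hsq.
    assert (H2 : 0 <= (e * a + p) ^ 2 + (e * b + q) ^ 2) by apply Hsq.
    replace ((e * a - p) ^ 2 + (e * b - q) ^ 2) with (r + (p ^ 2 + q ^ 2) - 2 * e * (a * p + b * q))
      in H1 by (unfold r; ring).
    replace ((e * a + p) ^ 2 + (e * b + q) ^ 2) with (r + (p ^ 2 + q ^ 2) + 2 * e * (a * p + b * q))
      in H2 by (unfold r; ring).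
    rewrite Hunit in H1, H2.
    replace (2 * (e * e) * (a * p + b * q)) with (e * (2 * e * (a * p + b * q))) by ring.
    replace (- (e * (1 + 2 * B))) with (e * (- (1 + 2 * B))) by ring.
    split; apply Rmult_le_compat_l; lra. }
  assert (Hr0 : 0 <= e * e * r <= e * (2 * B)).
  { split; [apply Rmult_le_pos; nra|].
    rewrite Rmult_assoc. apply Rmult_le_compat_l; [lra|]. nra. }
  set (X := 4 * (e * e) * (a * p + b * q) + 4 * (e * e) * r) in *.
  assert (HX : -(e * (2 + 12 * B)) <= X <= e * (2 + 12 * B)) by (unfold X; split; lra).
  assert (Hvab := Hv a b).
  assert (HvX : -(e * (2 + 12 * B)) <= v a b * X).
  { clearbody X. nra. }
  assert (e * e <= e) by nra.
  lra.
Qed.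

(* Inverse of [s |-> b tanh (b s)]; for [b > 1] it stays bounded on [[-1, 1]]. *)
Definition atanh_scaled (b v : R) : R := (ln (b + v) - ln (b - v)) / (2 * b).

Lemma is_derive_atanh_scaled (b v : R) :
  1 < b -> -1 <= v <= 1 -> is_derive (atanh_scaled b) v (/ (b ^ 2 - v ^ 2)).
Proof.
  intros Hb Hv. unfold atanh_scaled. auto_derive.
  - repeat split; lra.
  - field. repeat split; nra.
Qed.

Lemma atanh_scaled_increasing (b x y : R) :
  1 < b -> -1 <= x <= 1 -> -1 <= y <= 1 -> x < y -> atanh_scaled b x < atanh_scaled b y.
Proof.
  intros Hb Hx Hy Hxy.
  destruct (MVT_cor2 (atanh_scaled b) (fun z => / (b ^ 2 - z ^ 2)) x y Hxy) as [c [Hc Hin]].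
  - intros c Hc. apply is_derive_Reals, is_derive_atanh_scaled; lra.
  - assert (0 < / (b ^ 2 - c ^ 2)) by (apply Rinv_0_lt_compat; nra).
    assert (0 < / (b ^ 2 - c ^ 2) * (y - x)) by (apply Rmult_lt_0_compat; lra).
    lra.
Qed.

(** Supplies the growth hypothesis on [phi] in [two_point_estimate]. The function
    [z / (b^2 - z^2) - atanh_scaled b z] is nondecreasing, its derivative being
    [2 z^2 / (b^2 - z^2)^2], and the hypothesis forces [y <= x]. *)
Lemma atanh_scaled_diff_le (b x y : R) :
  1 < b -> -1 <= x <= 1 -> -1 <= y <= 1 -> atanh_scaled b y <= atanh_scaled b x ->
  atanh_scaled b x - atanh_scaled b y <= x / (b ^ 2 - x ^ 2) - y / (b ^ 2 - y ^ 2).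
Proof.
  intros Hb Hx Hy Hle.
  destruct (Rlt_le_dec x y) as [H|H].
  { assert (Hc := atanh_scaled_increasing b x y Hb Hx Hy H). lra. }
  destruct (Rle_lt_or_eq_dec y x H) as [Hlt| ->]; [|lra].
  destruct (MVT_cor2 (fun z => z / (b ^ 2 - z ^ 2) - atanh_scaled b z)
    (fun z => (b ^ 2 + z ^ 2) / (b ^ 2 - z ^ 2) ^ 2 - / (b ^ 2 - z ^ 2)) y x Hlt)
    as [c [Hc Hin]].
  - intros c Hc. assert (0 < b ^ 2 - c ^ 2) by nra.
    apply is_derive_Reals.
    apply (is_derive_minus (fun z => z / (b ^ 2 - z ^ 2)) (atanh_scaled b)).
    + auto_derive; [lra | field; lra].
    + apply is_derive_atanh_scaled; lra.
  - assert (Hp : 0 < b ^ 2 - c ^ 2) by nra.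
    assert (0 <= (b ^ 2 + c ^ 2) / (b ^ 2 - c ^ 2) ^ 2 - / (b ^ 2 - c ^ 2)).
    { replace ((b ^ 2 + c ^ 2) / (b ^ 2 - c ^ 2) ^ 2 - / (b ^ 2 - c ^ 2))
        with (2 * c ^ 2 * (/ (b ^ 2 - c ^ 2)) ^ 2) by (field; lra).
      assert (0 <= c ^ 2) by nra. apply Rmult_le_pos; [lra|]. apply pow2_ge_0. }
    assert (0 <= ((b ^ 2 + c ^ 2) / (b ^ 2 - c ^ 2) ^ 2 - / (b ^ 2 - c ^ 2)) * (x - y))
      by (apply Rmult_le_pos; lra).
    lra.
Qed.

Lemma Lipschitz_1_derive (f : R -> R) (x l : R) :
  (forall y z, f y - f z <= Rabs (y - z)) -> is_derive f x l -> Rabs l <= 1.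
Proof.
  intros HL Hd. apply is_derive_Reals in Hd.
  apply Rnot_lt_le; intros H.
  destruct (Hd (Rabs l - 1)) as [d Hdd]; [lra|].
  assert (Hdp := cond_pos d).
  specialize (Hdd (d / 2) ltac:(lra)).
  rewrite (Rabs_right (d / 2)) in Hdd by lra.
  specialize (Hdd ltac:(lra)).
  assert (Hq : Rabs ((f (x + d / 2) - f x) / (d / 2)) <= 1).
  { unfold Rdiv at 1. rewrite Rabs_mult, (Rabs_right (/ (d / 2))).
    - apply Rmult_le_reg_r with (d / 2); [lra|].
      rewrite Rmult_assoc, Rinv_l, Rmult_1_r, Rmult_1_l by lra.
      assert (H1 := HL (x + d / 2) x). assert (H2 := HL x (x + d / 2)).
      replace (x + d / 2 - x) with (d / 2) in H1 by ring.
      replace (x - (x + d / 2)) with (- (d / 2)) in H2 by ring.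
      rewrite Rabs_Ropp in H2. rewrite Rabs_right in H1, H2 by lra.
      apply Rabs_le; lra.
    - apply Rle_ge, Rlt_le, Rinv_0_lt_compat; lra. }
  assert (Ht := Rabs_triang_inv l ((f (x + d / 2) - f x) / (d / 2))).
  rewrite Rabs_minus_sym in Ht. lra.
Qed.

(** For [b > 1] the function [w = atanh_scaled b v] is bounded, and its Laplacian is [2 v (|grad
    w|^2 - 1) + 2 (b^2 - 1) v / (b^2 - v^2)], as [two_point_estimate] requires. So [w] is
    1-Lipschitz, which gives [|vt| <= b^2 - v^2]; then [b] tends to 1. *)
Lemma modica_bound v vt vs vtt vts vss :
  C2_jet v vt vs vtt vts vss -> allen_cahn v vtt vss ->
  (forall t s, -1 <= v t s <= 1) ->
  forall t s, vt t s ^ 2 <= (1 - v t s ^ 2) ^ 2.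
Proof.
  intros J E Hv.
  assert (Hb : forall b, 1 < b -> forall t s, Rabs (vt t s) <= b ^ 2 - v t s ^ 2).
  { intros b Hb.
    assert (HP : forall t s, 0 < b ^ 2 - v t s ^ 2) by (intros t s; specialize (Hv t s); nra).
    set (w := fun t s => atanh_scaled b (v t s)).
    assert (D1 : forall (g : R -> R) x l, -1 <= g x <= 1 -> is_derive g x l ->
      is_derive (fun z => atanh_scaled b (g z)) x (l / (b ^ 2 - g x ^ 2))).
    { intros g x l Hg Hd.
      apply (is_derive_comp (atanh_scaled b) g x _ l); [|exact Hd].
      apply is_derive_atanh_scaled; lra. }
    assert (D2 : forall (g g' : R -> R) x l, 0 < b ^ 2 - g x ^ 2 -> is_derive g x (g' x) ->
      is_derive g' x l ->
      is_derive (fun z => g' z / (b ^ 2 - g z ^ 2)) x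
        (l / (b ^ 2 - g x ^ 2) + 2 * g x * g' x ^ 2 / (b ^ 2 - g x ^ 2) ^ 2)).
    { intros g g' x l Hg Hd Hd2. auto_derive.
      - repeat split; try (eexists; eassumption). lra.
      - replace (Derive (fun z : R => g z) x) with (g' x) by (symmetry; now apply is_derive_unique).
        replace (Derive (fun z : R => g' z) x) with l by (symmetry; now apply is_derive_unique).
        field. lra. }
    assert (TP := two_point_estimate w
      (fun t s => vt t s / (b ^ 2 - v t s ^ 2)) (fun t s => vs t s / (b ^ 2 - v t s ^ 2))
      (fun t s => vtt t s / (b ^ 2 - v t s ^ 2)
                  + 2 * v t s * vt t s ^ 2 / (b ^ 2 - v t s ^ 2) ^ 2)
      (fun t s => vss t s / (b ^ 2 - v t s ^ 2)
                  + 2 * v t s * vs t s ^ 2 / (b ^ 2 - v t s ^ 2) ^ 2)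
      v (fun z => z / (b ^ 2 - z ^ 2))
      (Rabs (atanh_scaled b 1) + Rabs (atanh_scaled b (-1))) (2 * (b ^ 2 - 1))).
    assert (HL : forall t s t' s', w t s - w t' s' <= sqrt ((t - t') ^ 2 + (s - s') ^ 2)).
    { apply TP; clear TP; try exact Hv.
      - intros t s. apply (D1 (fun z => v z s)); [apply Hv | apply (jet_t _ _ _ _ _ _ J)].
      - intros t s. apply (D1 (fun z => v t z)); [apply Hv | apply (jet_s _ _ _ _ _ _ J)].
      - intros t s. apply (D2 (fun z => v z s) (fun z => vt z s));
          [apply HP | apply (jet_t _ _ _ _ _ _ J) | apply (jet_tt _ _ _ _ _ _ J)].
      - intros t s. apply (D2 (fun z => v t z) (fun z => vs t z));
          [apply HP | apply (jet_s _ _ _ _ _ _ J) | apply (jet_ss _ _ _ _ _ _ J)].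
      - intros t s. apply (continuity_1d_2d_pt_comp (atanh_scaled b) v);
          [|apply (jet_c _ _ _ _ _ _ J)].
        apply continuity_pt_filterlim, (ex_derive_continuous (atanh_scaled b)).
        eexists. apply is_derive_atanh_scaled; [lra | apply Hv].
      - intros t s. unfold w. specialize (Hv t s).
        assert (H1 : atanh_scaled b (v t s) <= atanh_scaled b 1).
        { destruct (Rle_lt_or_eq_dec _ _ (proj2 Hv)) as [H| ->]; [|lra].
          apply Rlt_le, atanh_scaled_increasing; lra. }
        assert (H2 : atanh_scaled b (-1) <= atanh_scaled b (v t s)).
        { destruct (Rle_lt_or_eq_dec _ _ (proj1 Hv)) as [H| <-]; [|lra].
          apply Rlt_le, atanh_scaled_increasing; lra. }
        assert (H3 := Rle_abs (atanh_scaled b 1)).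
        assert (H4 := Rle_abs (- atanh_scaled b (-1))). rewrite Rabs_Ropp in H4.
        assert (H5 := Rabs_pos (atanh_scaled b 1)).
        assert (H6 := Rabs_pos (atanh_scaled b (-1))).
        apply Rabs_le; lra.
      - nra.
      - intros t s. specialize (HP t s). specialize (E t s).
        replace (vtt t s) with (- 2 * v t s * (1 - v t s ^ 2) - vss t s) by lra.
        field. lra.
      - intros t s t' s' H. apply atanh_scaled_diff_le; auto. }
    intros t s. specialize (HP t s).
    assert (H1 : Rabs (vt t s / (b ^ 2 - v t s ^ 2)) <= 1).
    { apply (Lipschitz_1_derive (fun z => w z s) t).
      - intros y z. specialize (HL y s z s).
        replace ((y - z) ^ 2 + (s - s) ^ 2) with (Rsqr (y - z)) in HL by (unfold Rsqr; ring).
        rewrite sqrt_Rsqr_abs in HL. exact HL.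
      - apply (D1 (fun z => v z s)); [apply Hv | apply (jet_t _ _ _ _ _ _ J)]. }
    unfold Rdiv in H1. rewrite Rabs_mult, (Rabs_right (/ _)) in H1
      by (apply Rle_ge, Rlt_le, Rinv_0_lt_compat; lra).
    apply (Rmult_le_compat_r (b ^ 2 - v t s ^ 2)) in H1; [|lra].
    rewrite Rmult_assoc, Rinv_l in H1; lra. }
  intros t s.
  assert (H : Rabs (vt t s) <= 1 - v t s ^ 2).
  { apply Rnot_lt_le; intros Hc.
    set (m := Rabs (vt t s) - (1 - v t s ^ 2)).
    assert (Hm : 0 < m) by (unfold m; lra).
    (* For [b = 1 + e] with [e <= 1], the loss [b ^ 2 - 1 = 2 * e + e ^ 2] is at most [3 * e]. *)
    destruct (exists_small_pos m 3) as [e [He Hem]]; [lra|lra|].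
    specialize (Hb (1 + e) ltac:(lra) t s). unfold m in *. nra. }
  assert (H0 := Rabs_pos (vt t s)).
  replace (vt t s ^ 2) with (Rabs (vt t s) ^ 2) by apply pow2_abs.
  apply pow_incr; lra.
Qed.

(** * Auxiliary facts on ordinary differential equations and integrals *)

(** A Gronwall argument: since [|2 k| <= 4], [E^2 exp (4 t)] is nondecreasing and [E^2 exp (-4 t)]
    nonincreasing. Both vanish at 0, so the first settles negative times and the second positive
    ones. *)
Lemma linear_ode_zero (E k : R -> R) :
  (forall t, is_derive E t (k t * E t)) -> (forall t, -2 <= k t <= 2) -> E 0 = 0 ->
  forall t, E t = 0.
Proof.
  intros HE Hk H0.
  assert (Hg : forall a t, is_derive (fun z => E z ^ 2 * exp (a * z)) t
                 ((2 * k t + a) * (E t ^ 2 * exp (a * t)))).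
  { intros a t. auto_derive.
    - eexists; apply HE.
    - replace (Derive (fun z : R => E z) t) with (k t * E t)
        by (symmetry; apply is_derive_unique, HE). ring. }
  assert (Hp : forall a z, 0 <= E z ^ 2 * exp (a * z)).
  { intros a z. apply Rmult_le_pos; [apply pow2_ge_0 | apply Rlt_le, exp_pos]. }
  assert (Hz : forall a t, E t ^ 2 * exp (a * t) <= 0 -> E t = 0).
  { intros a t H. assert (He := exp_pos (a * t)). assert (Hs := pow2_ge_0 (E t)).
    assert (E t ^ 2 = 0) by (destruct (Rle_lt_or_eq_dec _ _ Hs) as [Hl|]; nra).
    nra. }
  intros t. destruct (Rtotal_order t 0) as [Ht|[->|Ht]]; [|exact H0|].
  - apply (Hz 4).
    destruct (MVT_cor2 (fun z => E z ^ 2 * exp (4 * z)) _ t 0 Ht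
      (fun c _ => proj1 (is_derive_Reals _ _ _) (Hg 4 c))) as [c [Hc _]].
    rewrite H0 in Hc. specialize (Hp 4 c). specialize (Hk c).
    assert (0 <= (2 * k c + 4) * (E c ^ 2 * exp (4 * c)) * (0 - t))
      by (apply Rmult_le_pos; [apply Rmult_le_pos; [lra | exact Hp] | lra]).
    lra.
  - apply (Hz (-4)).
    destruct (MVT_cor2 (fun z => E z ^ 2 * exp (-4 * z)) _ 0 t Ht
      (fun c _ => proj1 (is_derive_Reals _ _ _) (Hg (-4) c))) as [c [Hc _]].
    rewrite H0 in Hc. specialize (Hp (-4) c). specialize (Hk c).
    assert (0 <= - (2 * k c + -4) * (E c ^ 2 * exp (-4 * c)) * (t - 0))
      by (apply Rmult_le_pos; [apply Rmult_le_pos; [lra | exact Hp] | lra]).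
    lra.
Qed.

(* Both the defect in [y' = y^2 - 1] and the defect in the Moebius relation solve
   linear equations, so they vanish identically once they vanish at [0]. *)
Lemma heteroclinic_ode (y y' y'' : R -> R) :
  (forall t, is_derive y t (y' t)) -> (forall t, is_derive y' t (y'' t)) ->
  (forall t, -1 <= y t <= 1) ->
  (forall t, y'' t = - 2 * y t * (1 - y t ^ 2)) ->
  y' 0 = - (1 - y 0 ^ 2) ->
  forall t, (1 + y 0) * (1 - y t) = (1 - y 0) * (1 + y t) * exp t ^ 2.
Proof.
  intros Hy Hy' Hb Heq H0.
  (* This defect satisfies [E' = -2 y E], and the next one [D' = (1 + y) D]; both rates lie in
     [[-2, 2]]. *)
  assert (HE : forall t, y' t + (1 - y t ^ 2) = 0).
  { apply (linear_ode_zero _ (fun t => - 2 * y t)); [|intros t; specialize (Hb t); lra|lra].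
    intros t. auto_derive.
    - repeat split; eexists; [apply Hy' | apply Hy].
    - replace (Derive (fun z : R => y z) t) with (y' t) by (symmetry; apply is_derive_unique, Hy).
      replace (Derive (fun z : R => y' z) t) with (y'' t) by (symmetry; apply is_derive_unique, Hy').
      rewrite Heq. ring. }
  assert (HD : forall t, (1 + y 0) * (1 - y t) - (1 - y 0) * (1 + y t) * exp t ^ 2 = 0).
  { apply (linear_ode_zero _ (fun t => 1 + y t));
      [|intros t; specialize (Hb t); lra|rewrite exp_0; ring].
    intros t. auto_derive.
    - repeat split; eexists; apply Hy.
    - replace (Derive (fun z : R => y z) t) with (- (1 - y t ^ 2))
        by (symmetry; apply is_derive_unique; specialize (HE t);
            replace (- (1 - y t ^ 2)) with (y' t) by lra; apply Hy).
      ring. }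
  intros t. specialize (HD t). lra.
Qed.

(** Turns closeness of [F] to a constant at three times into smallness of [F''] at one time [x].
    Only the upper bound on [x] is recorded, because the limit is taken at minus infinity. *)
Lemma second_difference (F F' F'' : R -> R) (t : R) :
  (forall z, is_derive F z (F' z)) -> (forall z, is_derive F' z (F'' z)) ->
  exists x, x < t + 1 /\ F (t + 1) - 2 * F t + F (t - 1) = F'' x.
Proof.
  intros H1 H2.
  destruct (MVT_cor2 (fun z => F (z + 1) - F z) (fun z => F' (z + 1) - F' z) (t - 1) t)
    as [c [Hc Hin]]; [lra| |].
  - intros c _. apply is_derive_Reals. auto_derive.
    + repeat split; eexists; apply H1.
    + replace (Derive (fun z : R => F z) (c + 1)) with (F' (c + 1))
        by (symmetry; apply is_derive_unique, H1).
      replace (Derive (fun z : R => F z) c) with (F' c)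
        by (symmetry; apply is_derive_unique, H1). ring.
  - destruct (MVT_cor2 F' F'' c (c + 1)) as [x [Hx Hxin]]; [lra| |].
    + intros z _. apply is_derive_Reals, H2.
    + exists x; split; [lra|].
      replace (t - 1 + 1) with t in Hc by ring.
      replace (c + 1 - c) with 1 in Hx by ring. replace (t - (t - 1)) with 1 in Hc by ring.
      lra.
Qed.

(** The slope [F'] is monotone, so a nonzero slope at [x] persists on one side of [x]; over a length
    [(2 * M + 1) / |F' x|] it changes [F] by at least [2 * M + 1], more than the bound allows. *)
Lemma bounded_convex_second_derive_zero (F F' F'' : R -> R) (M : R) :
  (forall z, is_derive F z (F' z)) -> (forall z, is_derive F' z (F'' z)) ->
  (forall z, 0 <= F'' z) -> (forall z, Rabs (F z) <= M) ->
  forall z, F'' z = 0.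
Proof.
  intros H1 H2 Hp HM.
  assert (Hmono : forall x y, x < y -> F' x <= F' y).
  { intros x y Hxy.
    destruct (MVT_cor2 F' F'' x y Hxy (fun c _ => proj1 (is_derive_Reals _ _ _) (H2 c)))
      as [c [Hc _]].
    assert (0 <= F'' c * (y - x)) by (apply Rmult_le_pos; [apply Hp|lra]). lra. }
  assert (HM0 : 0 <= M) by (generalize (HM 0) (Rabs_pos (F 0)); lra).
  assert (HF : forall x y, F x - F y <= 2 * M).
  { intros x y. assert (Hx := HM x). assert (Hy := HM y).
    apply Rabs_le_between in Hx, Hy. lra. }
  assert (HF' : forall x, F' x = 0).
  { intros x.
    destruct (Rtotal_order (F' x) 0) as [H|[H|H]]; [exfalso|exact H|exfalso].
    - assert (Hq : 0 < (2 * M + 1) / - F' x) by (apply Rdiv_lt_0_compat; lra).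
      destruct (MVT_cor2 F F' (x - (2 * M + 1) / - F' x) x)  as [c [Hc Hin]];
        [lra|intros; apply is_derive_Reals, H1|].
      specialize (Hmono c x ltac:(lra)).
      specialize (HF (x - (2 * M + 1) / - F' x) x).
      assert (E : - F' x * ((2 * M + 1) / - F' x) = 2 * M + 1) by (field; lra).
      assert (- F' x * ((2 * M + 1) / - F' x) <= - F' c * ((2 * M + 1) / - F' x))
        by (apply Rmult_le_compat_r; lra).
      lra.
    - assert (Hq : 0 < (2 * M + 1) / F' x) by (apply Rdiv_lt_0_compat; lra).
      destruct (MVT_cor2 F F' x (x + (2 * M + 1) / F' x))  as [c [Hc Hin]];
        [lra|intros; apply is_derive_Reals, H1|].
      specialize (Hmono x c ltac:(lra)).
      specialize (HF (x + (2 * M + 1) / F' x) x).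
      assert (E : F' x * ((2 * M + 1) / F' x) = 2 * M + 1) by (field; lra).
      assert (F' x * ((2 * M + 1) / F' x) <= F' c * ((2 * M + 1) / F' x))
        by (apply Rmult_le_compat_r; lra).
      lra. }
  intros z. rewrite <- (is_derive_unique _ _ _ (H2 z)).
  rewrite (Derive_ext _ (fun _ => 0)); [apply Derive_const | exact HF'].
Qed.

Lemma RInt_zero_nonneg (f : R -> R) (a b : R) :
  a < b -> (forall x, continuous f x) -> (forall x, 0 <= f x) -> RInt f a b = 0 ->
  forall x, a <= x <= b -> f x = 0.
Proof.
  intros Hab Hc Hp HI x Hx.
  destruct (Rle_lt_or_eq_dec _ _ (Hp x)) as [H|H]; [exfalso|now symmetry].
  destruct (proj1 (filterlim_locally (F := locally x) f (f x)) (Hc x) (mkposreal _ H)) as [d Hd].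
  assert (Hdp := cond_pos d).
  (* The interval of positivity is clipped to [[a, b]], as [x] may be an endpoint. *)
  set (c := Rmax a (x - d / 2)). set (e := Rmin b (x + d / 2)).
  assert (H1 : a <= c) by apply Rmax_l. assert (H2 : x - d / 2 <= c) by apply Rmax_r.
  assert (H3 : e <= b) by apply Rmin_l. assert (H4 : e <= x + d / 2) by apply Rmin_r.
  assert (H5 : c < e).
  { unfold c, e. apply Rmax_lub_lt; apply Rmin_glb_lt; lra. }
  assert (Hex : forall u w, ex_RInt f u w).
  { intros u w. apply (ex_RInt_continuous f). intros; apply Hc. }
  assert (Hpos : 0 < RInt f c e).
  { apply RInt_gt_0; [exact H5| |intros; apply Hc].
    intros z Hz. assert (Hb : ball x d z).
    { change (Rabs (z - x) < d). apply Rabs_def1; lra. }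
    specialize (Hd z Hb). change (Rabs (f z - f x) < f x) in Hd.
    apply Rabs_def2 in Hd. lra. }
  assert (H6 : 0 <= RInt f a c) by (apply RInt_ge_0; auto).
  assert (H7 : 0 <= RInt f e b) by (apply RInt_ge_0; auto).
  assert (H8 : RInt f a c + RInt f c e = RInt f a e) by (apply (RInt_Chasles f a c e); auto).
  assert (H9 : RInt f a e + RInt f e b = RInt f a b) by (apply (RInt_Chasles f a e b); auto).
  lra.
Qed.

(** * Integrals over one period of the angle *)

Lemma continuous_slice (f : R -> R -> R) (t s : R) :
  continuity_2d_pt f t s -> continuous (fun z => f t z) s.
Proof.
  intros H. apply (continuous_comp_2 (fun _ => t) (fun z => z) f).
  - apply continuous_const.
  - apply continuous_id.
  - now apply continuity_2d_pt_filterlim.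
Qed.

Definition circle_int (f : R -> R -> R) (t : R) : R := RInt (fun s => f t s) 0 (2 * PI).

Lemma ex_circle_int (f : R -> R -> R) (t : R) :
  (forall t s, continuity_2d_pt f t s) -> ex_RInt (fun s => f t s) 0 (2 * PI).
Proof.
  intros H. apply (ex_RInt_continuous (fun s => f t s)). intros z _. now apply continuous_slice.
Qed.

Lemma is_derive_circle_int (f ft : R -> R -> R) :
  (forall t s, is_derive (fun z => f z s) t (ft t s)) ->
  (forall t s, continuity_2d_pt f t s) -> (forall t s, continuity_2d_pt ft t s) ->
  forall t, is_derive (circle_int f) t (circle_int ft t).
Proof.
  intros Hd Hf Hft t.
  assert (E : forall t s, Derive (fun z => f z s) t = ft t s).
  { intros; apply is_derive_unique, Hd. }
  unfold circle_int.
  rewrite (RInt_ext (fun s => ft t s) (fun s => Derive (fun z => f z s) t)).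
  2: { intros; now rewrite E. }
  apply (is_derive_RInt_param f).
  - apply filter_forall. intros x s _. eexists; apply Hd.
  - intros s _. apply continuity_2d_pt_ext with ft; [intros; now rewrite E | apply Hft].
  - apply filter_forall. intros x. now apply ex_circle_int.
Qed.

(** Integration by parts over a period: the integrands differ by the angular derivative of [h],
    whose boundary terms cancel. *)
Lemma circle_int_parts (f g h : R -> R -> R) (t : R) :
  (forall t s, continuity_2d_pt f t s) -> (forall t s, continuity_2d_pt g t s) ->
  (forall s, is_derive (fun z => h t z) s (f t s - g t s)) -> h t (2 * PI) = h t 0 ->
  circle_int f t = circle_int g t.
Proof.
  intros Hf Hg Hh Hper. unfold circle_int.
  assert (H : is_RInt (fun s => f t s - g t s) 0 (2 * PI) (minus (h t (2 * PI)) (h t 0))).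
  { apply (is_RInt_derive (fun s => h t s)); [intros; apply Hh|].
    intros s _. apply (continuous_minus (V := R_NormedModule)); now apply continuous_slice. }
  apply (is_RInt_unique (V := R_CompleteNormedModule)) in H.
  assert (H' : RInt (fun s => f t s - g t s) 0 (2 * PI)
             = RInt (fun s => f t s) 0 (2 * PI) - RInt (fun s => g t s) 0 (2 * PI)).
  { apply (RInt_minus (V := R_CompleteNormedModule)); now apply ex_circle_int. }
  rewrite H' in H. unfold minus, plus, opp in H; simpl in H. rewrite Hper in H. lra.
Qed.

Lemma circle_int_affine (f : R -> R -> R) (a k t : R) :
  (forall t s, continuity_2d_pt f t s) ->
  circle_int (fun t s => a * f t s + k) t = a * circle_int f t + 2 * PI * k.
Proof.
  intros Hf. unfold circle_int.
  apply (is_RInt_unique (V := R_CompleteNormedModule)).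
  apply (is_RInt_plus (V := R_NormedModule) (fun s => a * f t s) (fun _ => k)).
  - apply (is_RInt_scal (V := R_NormedModule)). apply (RInt_correct (V := R_CompleteNormedModule)).
    now apply ex_circle_int.
  - replace (2 * PI * k) with (scal (2 * PI - 0) k).
    + apply (is_RInt_const (V := R_NormedModule)).
    + unfold scal; simpl; unfold mult; simpl. ring.
Qed.

Lemma circle_int_plus (f g : R -> R -> R) (a b t : R) :
  (forall t s, continuity_2d_pt f t s) -> (forall t s, continuity_2d_pt g t s) ->
  circle_int (fun t s => a * f t s + b * g t s) t = a * circle_int f t + b * circle_int g t.
Proof.
  intros Hf Hg. unfold circle_int. apply (is_RInt_unique (V := R_CompleteNormedModule)).
  apply (is_RInt_plus (V := R_NormedModule) (fun s => a * f t s) (fun s => b * g t s));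
    apply (is_RInt_scal (V := R_NormedModule));
    apply (RInt_correct (V := R_CompleteNormedModule)); now apply ex_circle_int.
Qed.

Lemma circle_int_le (f g : R -> R -> R) (t : R) :
  (forall t s, continuity_2d_pt f t s) -> (forall t s, continuity_2d_pt g t s) ->
  (forall s, f t s <= g t s) -> circle_int f t <= circle_int g t.
Proof.
  intros Hf Hg H. apply RInt_le; try now apply ex_circle_int.
  - generalize PI_RGT_0; lra.
  - intros; apply H.
Qed.

Lemma circle_int_ext (f g : R -> R -> R) (t : R) :
  (forall s, f t s = g t s) -> circle_int f t = circle_int g t.
Proof. intros H. apply RInt_ext. intros; apply H. Qed.

(** * Solutions on the cylinder *)

Lemma continuity_2d_pt_pow (f : R -> R -> R) (n : nat) (x y : R) :
  continuity_2d_pt f x y -> continuity_2d_pt (fun t s => f t s ^ n) x y.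
Proof.
  intros Hf. apply (continuity_1d_2d_pt_comp (fun z => z ^ n)); [|exact Hf].
  apply derivable_continuous_pt, derivable_pt_pow.
Qed.

Ltac cont_2d J := intros; repeat first
  [ apply continuity_2d_pt_const | apply continuity_2d_pt_plus | apply continuity_2d_pt_minus
  | apply continuity_2d_pt_mult | apply continuity_2d_pt_pow | apply continuity_2d_pt_opp
  | apply (jet_c _ _ _ _ _ _ J) | apply (jet_ct _ _ _ _ _ _ J) | apply (jet_cs _ _ _ _ _ _ J)
  | apply (jet_ctt _ _ _ _ _ _ J) | apply (jet_cts _ _ _ _ _ _ J)
  | apply (jet_css _ _ _ _ _ _ J) ].

Lemma small_imp_zero (a C : R) :
  0 <= C -> (forall eta, 0 < eta <= 1 -> Rabs a <= C * eta) -> a = 0.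
Proof.
  intros HC H. destruct (Req_dec a 0) as [E|E]; [exact E|exfalso].
  apply Rabs_pos_lt in E.
  destruct (exists_small_pos (Rabs a) C E HC) as [e [He HeC]].
  specialize (H e He). lra.
Qed.

(** By the equation, the [t]-derivative of the integrand is the [s]-derivative of [-2 vt vs], which
    integrates to zero over a period. *)
Lemma hamiltonian_const v vt vs vtt vts vss :
  C2_jet v vt vs vtt vts vss -> allen_cahn v vtt vss ->
  (forall t, vt t (2 * PI) = vt t 0) -> (forall t, vs t (2 * PI) = vs t 0) ->
  exists h, forall t,
    circle_int (fun t s => vt t s ^ 2 - vs t s ^ 2 - (1 - v t s ^ 2) ^ 2) t = h.
Proof.
  intros J E Pt Ps.
  set (H := circle_int (fun t s => vt t s ^ 2 - vs t s ^ 2 - (1 - v t s ^ 2) ^ 2)).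
  assert (Dpoly : forall (p q r : R -> R) p' q' r' x,
    is_derive p x p' -> is_derive q x q' -> is_derive r x r' ->
    is_derive (fun z => p z ^ 2 - q z ^ 2 - (1 - r z ^ 2) ^ 2) x
      (2 * p x * p' - 2 * q x * q' + 4 * r x * (1 - r x ^ 2) * r')).
  { intros p q r p' q' r' x Hp Hq Hr. auto_derive.
    - repeat split; eexists; eassumption.
    - replace (Derive (fun z : R => p z) x) with p' by (symmetry; now apply is_derive_unique).
      replace (Derive (fun z : R => q z) x) with q' by (symmetry; now apply is_derive_unique).
      replace (Derive (fun z : R => r z) x) with r' by (symmetry; now apply is_derive_unique).
      ring. }
  assert (HD : forall t, is_derive H t 0).
  { intros t.
    replace 0 with (circle_int (fun t s => 2 * vt t s * vtt t s - 2 * vs t s * vts t s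
                          + 4 * v t s * (1 - v t s ^ 2) * vt t s) t).
    - apply is_derive_circle_int; [|cont_2d J|cont_2d J].
      clear t; intros t s.
      apply (Dpoly (fun z => vt z s) (fun z => vs z s) (fun z => v z s));
        [apply (jet_tt _ _ _ _ _ _ J) | apply (jet_st _ _ _ _ _ _ J) | apply (jet_t _ _ _ _ _ _ J)].
    - rewrite (circle_int_parts _ (fun _ _ => 0) (fun t s => -2 * vt t s * vs t s)).
      + unfold circle_int. rewrite (RInt_const (V := R_CompleteNormedModule)).
        apply Rmult_0_r.
      + cont_2d J.
      + cont_2d J.
      + intros s. specialize (E t s).
        replace (2 * vt t s * vtt t s - 2 * vs t s * vts t s
                 + 4 * v t s * (1 - v t s ^ 2) * vt t s - 0)
          with (-2 * (vts t s * vs t s + vt t s * vss t s))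
          by (replace (vtt t s) with (- 2 * v t s * (1 - v t s ^ 2) - vss t s) by lra; ring).
        apply is_derive_ext with (fun z => -2 * (vt t z * vs t z)); [intros; R_ring|].
        apply (is_derive_scal (fun z => vt t z * vs t z)).
        apply (is_derive_mult (fun z => vt t z) (fun z => vs t z));
          [apply (jet_ts _ _ _ _ _ _ J) | apply (jet_ss _ _ _ _ _ _ J) | intros; apply Rmult_comm].
      + rewrite Pt, Ps. reflexivity. }
  exists (H 0). intros t. change (H t = H 0).
  destruct (Rtotal_order t 0) as [Ht|[->|Ht]]; [|reflexivity|].
  - destruct (MVT_cor2 H (fun _ => 0) t 0 Ht) as [c [Hc _]];
      [intros; apply is_derive_Reals, HD | lra].
  - destruct (MVT_cor2 H (fun _ => 0) 0 t Ht) as [c [Hc _]];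
      [intros; apply is_derive_Reals, HD | lra].
Qed.

(** Integrand of the second derivative of the integral of [(v - c)^2]: the equation replaces [vtt],
    and the term [-2 (v - c) vss] becomes [2 vs^2] by parts. *)
Definition second_moment_rate (c : R) (v vt vs : R -> R -> R) (t s : R) : R :=
  2 * vt t s ^ 2 + 2 * vs t s ^ 2 - 4 * (v t s - c) * v t s * (1 - v t s ^ 2).

Lemma second_moment_derive v vt vs vtt vts vss c :
  C2_jet v vt vs vtt vts vss -> allen_cahn v vtt vss ->
  (forall t, v t (2 * PI) = v t 0) -> (forall t, vs t (2 * PI) = vs t 0) ->
  let A := circle_int (fun t s => (v t s - c) ^ 2) in
  let A' := circle_int (fun t s => 2 * (v t s - c) * vt t s) in
  (forall t, is_derive A t (A' t)) /\
  (forall t, is_derive A' t (circle_int (second_moment_rate c v vt vs) t)).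
Proof.
  intros J E P Ps A A'. split; intros t.
  - apply is_derive_circle_int; [|cont_2d J|cont_2d J].
    clear t; intros t s. auto_derive.
    + eexists; apply (jet_t _ _ _ _ _ _ J).
    + replace (Derive (fun z : R => v z s) t) with (vt t s)
        by (symmetry; apply is_derive_unique, (jet_t _ _ _ _ _ _ J)). ring.
  - replace (circle_int (second_moment_rate c v vt vs) t)
      with (circle_int (fun t s => 2 * vt t s ^ 2 + 2 * (v t s - c) * vtt t s) t).
    + apply is_derive_circle_int; [|cont_2d J|cont_2d J].
      clear t; intros t s. auto_derive.
      * repeat split; eexists; [apply (jet_t _ _ _ _ _ _ J) | apply (jet_tt _ _ _ _ _ _ J)].
      * replace (Derive (fun z : R => v z s) t) with (vt t s)
          by (symmetry; apply is_derive_unique, (jet_t _ _ _ _ _ _ J)).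
        replace (Derive (fun z : R => vt z s) t) with (vtt t s)
          by (symmetry; apply is_derive_unique, (jet_tt _ _ _ _ _ _ J)). ring.
    + apply (circle_int_parts _ _ (fun t s => -2 * ((v t s - c) * vs t s))).
      * cont_2d J.
      * unfold second_moment_rate; cont_2d J.
      * intros s. unfold second_moment_rate. specialize (E t s).
        replace (vtt t s) with (- 2 * v t s * (1 - v t s ^ 2) - vss t s) by lra.
        replace (2 * vt t s ^ 2 + 2 * (v t s - c) * (- 2 * v t s * (1 - v t s ^ 2) - vss t s) -
          (2 * vt t s ^ 2 + 2 * vs t s ^ 2 - 4 * (v t s - c) * v t s * (1 - v t s ^ 2)))
          with (-2 * ((vs t s - 0) * vs t s + (v t s - c) * vss t s)) by ring.
        apply (is_derive_scal (fun z => (v t z - c) * vs t z)).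
        apply (is_derive_mult (fun z => v t z - c) (fun z => vs t z));
          [|apply (jet_ss _ _ _ _ _ _ J)|intros; apply Rmult_comm].
        apply (is_derive_minus (fun z => v t z) (fun _ => c));
          [apply (jet_s _ _ _ _ _ _ J) | apply (is_derive_const (V := R_NormedModule))].
      * rewrite P, Ps. reflexivity.
Qed.

Lemma mean_derive v vt vs vtt vts vss :
  C2_jet v vt vs vtt vts vss -> allen_cahn v vtt vss ->
  (forall t, vs t (2 * PI) = vs t 0) ->
  (forall t, is_derive (circle_int v) t (circle_int vt t)) /\
  (forall t, is_derive (circle_int vt) t
     (circle_int (fun t s => - 2 * v t s * (1 - v t s ^ 2)) t)).
Proof.
  intros J E Ps. split; intros t.
  - apply is_derive_circle_int; [apply (jet_t _ _ _ _ _ _ J)|cont_2d J|cont_2d J].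
  - replace (circle_int (fun t s => - 2 * v t s * (1 - v t s ^ 2)) t) with (circle_int vtt t).
    + apply is_derive_circle_int; [apply (jet_tt _ _ _ _ _ _ J)|cont_2d J|cont_2d J].
    + apply (circle_int_parts _ _ (fun t s => - vs t s)).
      * cont_2d J.
      * cont_2d J.
      * intros s. specialize (E t s).
        replace (vtt t s - - 2 * v t s * (1 - v t s ^ 2)) with (- vss t s) by lra.
        apply (is_derive_opp (fun z => vs t z)), (jet_ss _ _ _ _ _ _ J).
      * now rewrite Ps.
Qed.

Lemma circle_int_abs_le (f : R -> R -> R) (t k : R) :
  (forall t s, continuity_2d_pt f t s) -> (forall s, Rabs (f t s) <= k) ->
  Rabs (circle_int f t) <= 2 * PI * k.
Proof.
  intros Hf Hk. replace (2 * PI) with (2 * PI - 0) by ring.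
  apply abs_RInt_le_const.
  - generalize PI_RGT_0; lra.
  - now apply ex_circle_int.
  - intros; apply Hk.
Qed.

(** A second difference of the integral of [v] far to the left is at most [8 PI eta]. It equals the
    integral of [-2 v (1 - v^2)] at some time, which is within [8 PI eta] of [-4 PI c (1 - c^2)]. *)
Lemma limit_is_equilibrium v vt vs vtt vts vss c :
  C2_jet v vt vs vtt vts vss -> allen_cahn v vtt vss ->
  (forall t s, -1 <= v t s <= 1) -> -1 <= c <= 1 ->
  (forall t, vs t (2 * PI) = vs t 0) ->
  (forall eta, 0 < eta -> exists T, forall t s, t < T -> Rabs (v t s - c) < eta) ->
  c * (1 - c ^ 2) = 0.
Proof.
  intros J E Hv Hc Ps Hlim.
  assert (HPI := PI_RGT_0).
  apply (small_imp_zero _ 4); [lra|]. intros eta Heta.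
  destruct (Hlim eta (proj1 Heta)) as [T HT].
  destruct (mean_derive _ _ _ _ _ _ J E Ps) as [D1 D2].
  (* Centred at [T - 2], the three sample times and [x] all lie below [T]. *)
  destruct (second_difference _ _ _ (T - 2) D1 D2) as [x [Hx Heq]].
  assert (HB : forall t, t < T -> Rabs (circle_int v t - 2 * PI * c) <= 2 * PI * eta).
  { intros t Ht.
    replace (circle_int v t - 2 * PI * c) with (circle_int (fun t s => 1 * v t s + - c) t)
      by (rewrite circle_int_affine; [ring | cont_2d J]).
    apply circle_int_abs_le; [cont_2d J|]. intros s. replace (1 * v t s + - c) with (v t s - c) by ring. now apply Rlt_le, HT. }
  assert (H1 := HB (T - 2 + 1) ltac:(lra)). assert (H2 := HB (T - 2) ltac:(lra)).
  assert (H3 := HB (T - 2 - 1) ltac:(lra)).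
  assert (H4 : Rabs (circle_int (fun t s => 1 * (- 2 * v t s * (1 - v t s ^ 2)) + 2 * c * (1 - c ^ 2)) x)
               <= 2 * PI * (4 * eta)).
  { apply circle_int_abs_le; [cont_2d J|]. intros s.
    specialize (HT x s ltac:(lra)). specialize (Hv x s).
    replace (1 * (- 2 * v x s * (1 - v x s ^ 2)) + 2 * c * (1 - c ^ 2))
      with ((v x s - c) * (- 2 * (1 - (v x s ^ 2 + v x s * c + c ^ 2)))) by ring.
    rewrite Rabs_mult, (Rmult_comm 4).
    apply Rmult_le_compat; try apply Rabs_pos; [lra|].
    apply Rabs_le; split; nra. }
  rewrite circle_int_affine in H4 by cont_2d J. rewrite <- Heq in H4.
  apply Rabs_le_between in H1, H2, H3, H4.
  apply Rabs_le. split; apply (Rmult_le_reg_l (4 * PI)); lra.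
Qed.

(** Where [v] is within [eta] of [c], the density plus [(1 - c^2)^2] is bounded by half of
    [second_moment_rate] plus [6 eta]. The integral of that rate is a second difference of the
    second moment at some time [x], hence small there; conservation carries the value to all
    times. *)
Lemma hamiltonian_value v vt vs vtt vts vss c :
  C2_jet v vt vs vtt vts vss -> allen_cahn v vtt vss ->
  (forall t s, -1 <= v t s <= 1) -> -1 <= c <= 1 ->
  (forall t, v t (2 * PI) = v t 0) ->
  (forall t, vt t (2 * PI) = vt t 0) -> (forall t, vs t (2 * PI) = vs t 0) ->
  (forall eta, 0 < eta -> exists T, forall t s, t < T -> Rabs (v t s - c) < eta) ->
  forall t, circle_int (fun t s => vt t s ^ 2 - vs t s ^ 2 - (1 - v t s ^ 2) ^ 2) t
            = - (2 * PI * (1 - c ^ 2) ^ 2).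
Proof.
  intros J E Hv Hc P Pt Ps Hlim t0.
  assert (HPI := PI_RGT_0).
  destruct (hamiltonian_const _ _ _ _ _ _ J E Pt Ps) as [h Hh].
  rewrite Hh. clear t0.
  apply Rminus_diag_uniq, (small_imp_zero _ (2 * PI * 8)); [lra|]. intros eta Heta.
  destruct (Hlim eta (proj1 Heta)) as [T HT].
  destruct (second_moment_derive _ _ _ _ _ _ c J E P Ps) as [D1 D2].
  destruct (second_difference _ _ _ (T - 2) D1 D2) as [x [Hx Heq]].
  assert (HA : forall t, t < T ->
    0 <= circle_int (fun t s => (v t s - c) ^ 2) t <= 2 * PI * eta).
  { intros t Ht. split.
    - apply RInt_ge_0; [lra | apply (ex_circle_int (fun t s => (v t s - c) ^ 2)); cont_2d J |].
      intros; apply pow2_ge_0.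
    - apply Rle_trans with (Rabs (circle_int (fun t s => (v t s - c) ^ 2) t)); [apply Rle_abs|].
      apply circle_int_abs_le; [cont_2d J|].
      intros s. specialize (HT t s Ht). rewrite <- RPow_abs.
      assert (H0 := Rabs_pos (v t s - c)). nra. }
  assert (H1 := HA (T - 2 + 1) ltac:(lra)). assert (H2 := HA (T - 2) ltac:(lra)).
  assert (H3 := HA (T - 2 - 1) ltac:(lra)).
  set (Q := second_moment_rate c v vt vs) in *.
  assert (CQ : forall t s, continuity_2d_pt Q t s)
    by (unfold Q, second_moment_rate; cont_2d J).
  set (F := fun t s => vt t s ^ 2 - vs t s ^ 2 - (1 - v t s ^ 2) ^ 2) in *.
  assert (CF : forall t s, continuity_2d_pt F t s) by (unfold F; cont_2d J).
  assert (Hpt : forall s, Rabs (F x s + (1 - c ^ 2) ^ 2) <= / 2 * Q x s + 6 * eta).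
  { intros s. specialize (HT x s ltac:(lra)). specialize (Hv x s).
    apply Rabs_def2 in HT.
    assert (B1 : -(4 * eta) <= (1 - c ^ 2) ^ 2 - (1 - v x s ^ 2) ^ 2 <= 4 * eta).
    { apply Rabs_le_between.
      replace ((1 - c ^ 2) ^ 2 - (1 - v x s ^ 2) ^ 2)
        with ((v x s - c) * ((v x s + c) * (2 - c ^ 2 - v x s ^ 2))) by ring.
      rewrite Rabs_mult, (Rmult_comm 4).
      apply Rmult_le_compat; try apply Rabs_pos; [apply Rabs_le; lra|].
      rewrite Rabs_mult. replace 4 with (2 * 2) by ring.
      apply Rmult_le_compat; try apply Rabs_pos; apply Rabs_le; nra. }
    assert (B2 : -(2 * eta) <= 2 * (v x s - c) * (v x s * (1 - v x s ^ 2)) <= 2 * eta).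
    { apply Rabs_le_between. rewrite Rabs_mult. rewrite <- (Rmult_1_r (2 * eta)).
      apply Rmult_le_compat; try apply Rabs_pos; [apply Rabs_le; lra|].
      apply Rabs_le; nra. }
    assert (S1 := pow2_ge_0 (vt x s)). assert (S2 := pow2_ge_0 (vs x s)).
    unfold F, Q, second_moment_rate. apply Rabs_le; split; lra. }
  assert (U : circle_int (fun t s => 1 * F t s + (1 - c ^ 2) ^ 2) x
              <= circle_int (fun t s => / 2 * Q t s + 6 * eta) x).
  { apply circle_int_le; [|cont_2d J; apply CQ|].
    - intros; apply continuity_2d_pt_plus;
        [apply continuity_2d_pt_mult; [apply continuity_2d_pt_const|apply CF]
        |apply continuity_2d_pt_const].
    - intros s. specialize (Hpt s). apply Rabs_le_between in Hpt. lra. }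
  assert (L : circle_int (fun t s => - / 2 * Q t s + - (6 * eta)) x
              <= circle_int (fun t s => 1 * F t s + (1 - c ^ 2) ^ 2) x).
  { apply circle_int_le; [cont_2d J; apply CQ| |].
    - intros; apply continuity_2d_pt_plus;
        [apply continuity_2d_pt_mult; [apply continuity_2d_pt_const|apply CF]
        |apply continuity_2d_pt_const].
    - intros s. specialize (Hpt s). apply Rabs_le_between in Hpt. lra. }
  rewrite !circle_int_affine in U, L by assumption.
  rewrite <- Heq in U, L. rewrite Hh in U, L.
  assert (HPe : 0 < PI * eta) by (apply Rmult_lt_0_compat; lra).
  apply Rabs_le; split; lra.
Qed.

(** * The possible limits at minus infinity and the resulting solutions *)

Lemma unstable_limit_trivial v vt vs vtt vts vss :
  C2_jet v vt vs vtt vts vss -> allen_cahn v vtt vss ->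
  (forall t s, -1 <= v t s <= 1) ->
  (forall t, v t (2 * PI) = v t 0) -> (forall t, vs t (2 * PI) = vs t 0) ->
  (forall t, circle_int (fun t s => vt t s ^ 2 - vs t s ^ 2 - (1 - v t s ^ 2) ^ 2) t
             = - (2 * PI)) ->
  forall t s, 0 <= s <= 2 * PI -> v t s = 0.
Proof.
  intros J E Hv P Ps Hh t s Hs.
  assert (HPI := PI_RGT_0).
  destruct (second_moment_derive _ _ _ _ _ _ 0 J E P Ps) as [D1 D2].
  set (G := fun t s => 4 * vt t s ^ 2 + 2 * v t s ^ 4).
  assert (CG : forall t s, continuity_2d_pt G t s) by (unfold G; cont_2d J).
  (* The conserved quantity trades the angular energy for the radial one. *)
  assert (HG : forall t, circle_int (second_moment_rate 0 v vt vs) t = circle_int G t).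
  { intros z.
    set (F := fun t s => vt t s ^ 2 - vs t s ^ 2 - (1 - v t s ^ 2) ^ 2) in *.
    rewrite (circle_int_ext G
      (fun t s => 1 * second_moment_rate 0 v vt vs t s + 1 * (2 * F t s + 2)))
      by (intros; unfold G, F, second_moment_rate; ring).
    rewrite circle_int_plus.
    - rewrite circle_int_affine, Hh; [ring|]. unfold F; cont_2d J.
    - unfold second_moment_rate; cont_2d J.
    - unfold F; cont_2d J. }
  assert (Hz : circle_int G t = 0).
  { rewrite <- HG.
    apply (bounded_convex_second_derive_zero _ _ _ (2 * PI * 1) D1 D2).
    - intros z. rewrite HG. apply RInt_ge_0; [lra | now apply ex_circle_int |].
      intros y _. unfold G. assert (H1 := pow2_ge_0 (vt z y)).
      assert (H2 := pow2_ge_0 (v z y ^ 2)). nra.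
    - intros z. apply circle_int_abs_le; [cont_2d J|]. intros y.
      specialize (Hv z y). apply Rabs_le; nra. }
  assert (HGs : G t s = 0).
  { apply (RInt_zero_nonneg (fun s => G t s) 0 (2 * PI)); try assumption; [lra| |].
    - intros; now apply continuous_slice.
    - intros y. unfold G. assert (H1 := pow2_ge_0 (vt t y)).
      assert (H2 := pow2_ge_0 (v t y ^ 2)). nra. }
  unfold G in HGs. assert (H1 := pow2_ge_0 (vt t s)). assert (H2 := pow2_ge_0 (v t s ^ 2)).
  assert (H3 : (v t s ^ 2) ^ 2 = 0) by nra.
  apply (Rsqr_0_uniq (v t s)), Rsqr_0_uniq. unfold Rsqr. lra.
Qed.

(** Modica's inequality gives the density a sign, so its zero integral forces it to vanish
    pointwise. *)
Lemma stable_limit_heteroclinic v vt vs vtt vts vss :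
  C2_jet v vt vs vtt vts vss -> allen_cahn v vtt vss ->
  (forall t s, -1 <= v t s <= 1) ->
  (forall t, circle_int (fun t s => vt t s ^ 2 - vs t s ^ 2 - (1 - v t s ^ 2) ^ 2) t = 0) ->
  forall t s, 0 <= s <= 2 * PI -> vs t s = 0 /\ vt t s ^ 2 = (1 - v t s ^ 2) ^ 2.
Proof.
  intros J E Hv Hh t s Hs.
  assert (HPI := PI_RGT_0).
  assert (HM := modica_bound _ _ _ _ _ _ J E Hv).
  set (F := fun t s => vt t s ^ 2 - vs t s ^ 2 - (1 - v t s ^ 2) ^ 2) in *.
  (* [- F] is [vs ^ 2] plus the gap in Modica's inequality; the affine shape matches
     [circle_int_affine]. *)
  assert (HF : forall s, 0 <= -1 * F t s + 0).
  { intros y. unfold F. specialize (HM t y). assert (H := pow2_ge_0 (vs t y)). lra. }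
  assert (Hz : -1 * F t s + 0 = 0).
  { apply (RInt_zero_nonneg (fun s => -1 * F t s + 0) 0 (2 * PI)); try assumption; [lra| |].
    - intros y. apply (continuous_slice (fun t s => -1 * F t s + 0)). unfold F; cont_2d J.
    - change (circle_int (fun t s => -1 * F t s + 0) t = 0).
      rewrite circle_int_affine, Hh; [ring|]. unfold F; cont_2d J. }
  unfold F in Hz. specialize (HM t s). assert (H := pow2_ge_0 (vs t s)).
  split; [apply Rsqr_0_uniq; unfold Rsqr; lra | lra].
Qed.

(** For [v0 < 1] this is [v = (a^2 - exp (2 t)) / (a^2 + exp (2 t))] with
    [a^2 = (1 + v0) / (1 - v0)]; without division it also covers [v0 = 1], where [v] is constant. *)
Definition moebius_relation (v : R -> R -> R) (v0 : R) : Prop :=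
  forall t s, 0 <= s <= 2 * PI ->
    (1 + v0) * (1 - v t s) = (1 - v0) * (1 + v t s) * exp t ^ 2.

(** As [vs] vanishes, [v] equals its restriction to the line [s = 1], where the equation becomes an
    ordinary one. The angle 1 is interior to the period, so [vss] vanishes there too. *)
Lemma heteroclinic_classification v vt vs vtt vts vss :
  C2_jet v vt vs vtt vts vss -> allen_cahn v vtt vss ->
  (forall t s, -1 <= v t s <= 1) ->
  (forall t s, 0 <= s <= 2 * PI -> vs t s = 0 /\ vt t s ^ 2 = (1 - v t s ^ 2) ^ 2) ->
  vt 0 1 = - (1 - v 0 1 ^ 2) ->
  moebius_relation v (v 0 1).
Proof.
  intros J E Hv H H0 t s Hs.
  assert (HPI := PI2_3_2). unfold PI2 in HPI.
  assert (Hvs : v t s = v t 1).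
  { destruct (MVT_gen (fun z => v t z) 1 s (vs t)) as [c [Hc Heq]].
    - intros; apply (jet_s _ _ _ _ _ _ J).
    - intros z _. apply continuity_pt_filterlim, (ex_derive_continuous (fun z => v t z)).
      eexists; apply (jet_s _ _ _ _ _ _ J).
    - destruct (H t c) as [Hz _]; [|rewrite Hz in Heq; lra].
      unfold Rmin, Rmax in Hc. destruct (Rle_dec 1 s); lra. }
  rewrite Hvs.
  apply (heteroclinic_ode (fun z => v z 1) (fun z => vt z 1) (fun z => vtt z 1)).
  - intros z; apply (jet_t _ _ _ _ _ _ J).
  - intros z; apply (jet_tt _ _ _ _ _ _ J).
  - intros z; apply Hv.
  - intros z. rewrite <- E.
    replace (vss z 1) with 0; [ring|].
    rewrite <- (is_derive_unique _ _ _ (jet_ss _ _ _ _ _ _ J z 1)).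
    rewrite (Derive_ext_loc _ (fun _ => 0)); [symmetry; apply Derive_const|].
    (* The angles between 0 and 2 lie within one period. *)
    exists (mkposreal 1 Rlt_0_1). intros y Hy. change (Rabs (y - 1) < 1) in Hy.
    apply Rabs_def2 in Hy. apply H. lra.
  - exact H0.
Qed.

Lemma cylinder_classification v vt vs vtt vts vss c :
  C2_jet v vt vs vtt vts vss -> allen_cahn v vtt vss ->
  (forall t s, -1 <= v t s <= 1) ->
  (forall t, v t (2 * PI) = v t 0) ->
  (forall t, vt t (2 * PI) = vt t 0) -> (forall t, vs t (2 * PI) = vs t 0) ->
  (forall eta, 0 < eta -> exists T, forall t s, t < T -> Rabs (v t s - c) < eta) ->
  (forall t s, 0 <= s <= 2 * PI -> v t s = 0) \/
  (exists v0, -1 <= v0 <= 1 /\ moebius_relation v v0) \/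
  (exists v0, -1 <= v0 <= 1 /\ moebius_relation (fun t s => - v t s) v0).
Proof.
  intros J E Hv P Pt Ps Hlim.
  assert (Hc : -1 <= c <= 1).
  { split; apply Rnot_lt_le; intros Hlt.
    - destruct (Hlim (-1 - c)) as [T HT]; [lra|].
      specialize (HT (T - 1) 0 ltac:(lra)). specialize (Hv (T - 1) 0).
      apply Rabs_def2 in HT. lra.
    - destruct (Hlim (c - 1)) as [T HT]; [lra|].
      specialize (HT (T - 1) 0 ltac:(lra)). specialize (Hv (T - 1) 0).
      apply Rabs_def2 in HT. lra. }
  assert (Hz := limit_is_equilibrium _ _ _ _ _ _ c J E Hv Hc Ps Hlim).
  assert (Hh := hamiltonian_value _ _ _ _ _ _ c J E Hv Hc P Pt Ps Hlim).
  apply Rmult_integral in Hz. destruct Hz as [Hz|Hz].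
  - left. apply (unstable_limit_trivial _ _ _ _ _ _ J E Hv P Ps).
    intros t. rewrite Hh, Hz. ring.
  - right.
    assert (H := stable_limit_heteroclinic _ _ _ _ _ _ J E Hv
      ltac:(intros t; rewrite Hh, Hz; ring)).
    assert (H01 := proj2 (H 0 1 ltac:(generalize PI2_3_2; unfold PI2; lra))).
    (* Equality in Modica's inequality leaves two signs for [vt] at one point; passing to [- v]
       reduces the increasing case to the decreasing one. *)
    assert (Hf : (vt 0 1 - (1 - v 0 1 ^ 2)) * (vt 0 1 + (1 - v 0 1 ^ 2)) = 0) by lra.
    apply Rmult_integral in Hf. destruct Hf as [Hf|Hf].
    + right. exists (- v 0 1). split; [specialize (Hv 0 1); lra|].
      apply (heteroclinic_classification _ _ _ _ _ _ (C2_jet_opp _ _ _ _ _ _ J)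
        (allen_cahn_opp _ _ _ E)).
      * intros t s. specialize (Hv t s). lra.
      * intros t s Hs. destruct (H t s Hs) as [H1 H2]. split; [rewrite H1; ring|].
        replace ((- vt t s) ^ 2) with (vt t s ^ 2) by ring. rewrite H2. ring.
      * lra.
    + left. exists (v 0 1). split; [apply Hv|].
      apply (heteroclinic_classification _ _ _ _ _ _ J E Hv H). lra.
Qed.

(** * Polar coordinates *)

Lemma locally_2d_punctured (x y : R) :
  (x, y) <> (0, 0) -> locally_2d (fun a b => (a, b) <> (0, 0)) x y.
Proof.
  intros H.
  assert (Hp : 0 < Rmax (Rabs x) (Rabs y)).
  { destruct (Req_dec x 0) as [->|Hx].
    - apply Rlt_le_trans with (Rabs y); [|apply Rmax_r].
      apply Rabs_pos_lt. intros ->; now apply H.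
    - apply Rlt_le_trans with (Rabs x); [|apply Rmax_l]. now apply Rabs_pos_lt. }
  exists (mkposreal _ Hp). simpl. intros a b Ha Hb E. injection E as -> ->.
  rewrite Rminus_0_l, Rabs_Ropp in Ha, Hb.
  apply (Rlt_irrefl (Rmax (Rabs x) (Rabs y))).
  now apply Rmax_lub_lt.
Qed.

(** The punctured plane is open, so [fx] exists near the point; its continuity there makes [f]
    differentiable, and the chain rule applies. *)
Lemma punctured_chain_rule (f fx fy : R -> R -> R) (p q : R -> R) (z p' q' : R) :
  (forall x y, (x, y) <> (0, 0) -> is_derive (fun a => f a y) x (fx x y)) ->
  (forall x y, (x, y) <> (0, 0) -> is_derive (fun a => f x a) y (fy x y)) ->
  (forall x y, (x, y) <> (0, 0) -> continuity_2d_pt fx x y) ->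
  is_derive p z p' -> is_derive q z q' -> (p z, q z) <> (0, 0) ->
  is_derive (fun a => f (p a) (q a)) z (p' * fx (p z) (q z) + q' * fy (p z) (q z)).
Proof.
  intros Dx Dy Cx Dp Dq Hne.
  apply is_derive_Reals. rewrite (Rmult_comm p'), (Rmult_comm q').
  apply derivable_pt_lim_comp_2d; [|now apply is_derive_Reals..].
  apply filterdiff_differentiable_pt_lim.
  apply (is_derive_filterdiff f (p z) (q z) fx (fy (p z) (q z))).
  - destruct (locally_2d_punctured _ _ Hne) as [d Hd].
    exists d. intros [a b] [Ha Hb]. apply Dx. now apply Hd.
  - now apply Dy.
  - now apply continuity_2d_pt_filterlim, Cx.
Qed.

Definition polar_x (t s : R) : R := exp t * cos s.
Definition polar_y (t s : R) : R := exp t * sin s.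

Lemma polar_sq (t s : R) : polar_x t s ^ 2 + polar_y t s ^ 2 = exp t ^ 2.
Proof.
  unfold polar_x, polar_y.
  replace (exp t ^ 2) with (exp t ^ 2 * (Rsqr (sin s) + Rsqr (cos s)))
    by (rewrite sin2_cos2; ring).
  unfold Rsqr; ring.
Qed.

Lemma polar_neq_0 (t s : R) : (polar_x t s, polar_y t s) <> (0, 0).
Proof.
  intros E. injection E as E1 E2. assert (H := polar_sq t s). assert (He := exp_pos t).
  rewrite E1, E2 in H. assert (0 < exp t ^ 2) by (apply pow_lt; lra). lra.
Qed.

Lemma polar_surjective (x y : R) :
  (x, y) <> (0, 0) ->
  exists t s, 0 <= s <= 2 * PI /\ x = polar_x t s /\ y = polar_y t s.
Proof.
  intros H.
  assert (Hp : 0 < x ^ 2 + y ^ 2).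
  { destruct (Req_dec x 0) as [->|Hx].
    - assert (y <> 0) by (intros ->; now apply H). nra.
    - nra. }
  set (r := sqrt (x ^ 2 + y ^ 2)).
  assert (Hr : 0 < r) by now apply sqrt_lt_R0.
  assert (Hr2 : r * r = x ^ 2 + y ^ 2) by (apply sqrt_sqrt; lra).
  assert (Hxr : -1 <= x / r <= 1).
  { split; apply (Rmult_le_reg_r r); try lra; unfold Rdiv;
      rewrite Rmult_assoc, Rinv_l by lra; nra. }
  assert (HPI := PI_RGT_0). assert (Ha := acos_bound (x / r)).
  assert (Hs : sin (acos (x / r)) = Rabs y / r).
  { rewrite sin_acos by exact Hxr.
    replace (1 - Rsqr (x / r)) with (Rsqr (y / r)).
    - rewrite sqrt_Rsqr_abs. unfold Rdiv. rewrite Rabs_mult, (Rabs_right (/ r)); [reflexivity|].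
      apply Rle_ge, Rlt_le, Rinv_0_lt_compat, Hr.
    - unfold Rsqr. replace (x / r * (x / r)) with (x ^ 2 / (r * r)) by (field; lra).
      replace (y / r * (y / r)) with (y ^ 2 / (r * r)) by (field; lra).
      rewrite Hr2. field. lra. }
  unfold polar_x, polar_y.
  exists (ln r). rewrite exp_ln by exact Hr.
  destruct (Rle_dec 0 y) as [Hy|Hy].
  - exists (acos (x / r)). rewrite cos_acos, Hs, Rabs_right by lra.
    repeat split; try lra; field; lra.
  (* In the lower half-plane the angle is reflected so as to stay in [[0, 2 * PI]]. *)
  - exists (2 * PI - acos (x / r)).
    replace (2 * PI - acos (x / r)) with (- acos (x / r) + 2 * INR 1 * PI) by (simpl; ring).
    rewrite cos_period, sin_period, cos_neg, sin_neg, cos_acos, Hs, Rabs_left by lra.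
    simpl. repeat split; try lra; field; lra.
Qed.

Lemma is_derive_polar_x_t t s : is_derive (fun z => polar_x z s) t (polar_x t s).
Proof. unfold polar_x. auto_derive; [exact I | ring]. Qed.
Lemma is_derive_polar_y_t t s : is_derive (fun z => polar_y z s) t (polar_y t s).
Proof. unfold polar_y. auto_derive; [exact I | ring]. Qed.
Lemma is_derive_polar_x_s t s : is_derive (fun z => polar_x t z) s (- polar_y t s).
Proof. unfold polar_x, polar_y. auto_derive; [exact I | ring]. Qed.
Lemma is_derive_polar_y_s t s : is_derive (fun z => polar_y t z) s (polar_x t s).
Proof. unfold polar_x, polar_y. auto_derive; [exact I | ring]. Qed.

Lemma continuity_polar (g : R -> R) (t s : R) :
  continuity g -> continuity_2d_pt (fun t s => exp t * g s) t s.
Proof.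
  intros Hg. apply continuity_2d_pt_mult.
  - apply (continuity_1d_2d_pt_comp exp (fun t _ => t)); [|apply continuity_2d_pt_id1].
    apply derivable_continuous_pt, derivable_pt_exp.
  - apply (continuity_1d_2d_pt_comp g (fun _ s => s)); [apply Hg|apply continuity_2d_pt_id2].
Qed.

Lemma continuity_polar_x t s : continuity_2d_pt polar_x t s.
Proof. apply continuity_polar, continuity_cos. Qed.
Lemma continuity_polar_y t s : continuity_2d_pt polar_y t s.
Proof. apply continuity_polar, continuity_sin. Qed.

Lemma continuity_polar_comp (f : R -> R -> R) (t s : R) :
  (forall x y, (x, y) <> (0, 0) -> continuity_2d_pt f x y) ->
  continuity_2d_pt (fun t s => f (polar_x t s) (polar_y t s)) t s.
Proof.
  intros Hf. apply continuity_2d_pt_filterlim.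
  apply (continuous_comp_2 (fun z : R * R => polar_x (fst z) (snd z))
    (fun z : R * R => polar_y (fst z) (snd z)) f (t, s)).
  - apply (proj1 (continuity_2d_pt_filterlim polar_x t s)), continuity_polar_x.
  - apply (proj1 (continuity_2d_pt_filterlim polar_y t s)), continuity_polar_y.
  - apply continuity_2d_pt_filterlim, Hf, polar_neq_0.
Qed.

(** Polar coordinates with logarithmic radius are conformal: [vtt + vss] is [exp (2 t)] times the
    Laplacian of [u], and this factor cancels the weight [1 / |x|^2]. *)
Lemma polar_jet (u : R -> R -> R) :
  C2_punctured_plane u -> continuous_plane u ->
  (forall x y : R, (x, y) <> (0, 0) ->
     - laplacian u x y = 2 / enorm x y ^ 2 * u x y * (1 - u x y ^ 2)) ->
  exists vt vs vtt vts vss,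
    let v := fun t s => u (polar_x t s) (polar_y t s) in
    C2_jet v vt vs vtt vts vss /\ allen_cahn v vtt vss /\
    (forall t, vt t (2 * PI) = vt t 0) /\ (forall t, vs t (2 * PI) = vs t 0).
Proof.
  intros H2 Hc Heq.
  set (u1 := fun x y => Derive (fun z => u z y) x).
  set (u2 := fun x y => Derive (fun z => u x z) y).
  set (u11 := fun x y => Derive (fun z => u1 z y) x).
  set (u12 := fun x y => Derive (fun z => u1 x z) y).
  set (u21 := fun x y => Derive (fun z => u2 z y) x).
  set (u22 := fun x y => Derive (fun z => u2 x z) y).
  assert (Hall : forall x y, (x, y) <> (0, 0) ->
    (ex_derive (fun z => u z y) x /\ ex_derive (fun z => u x z) y) /\
    (continuity_2d_pt u1 x y /\ ex_derive (fun z => u1 z y) x /\ ex_derive (fun z => u1 x z) y /\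
      continuity_2d_pt u11 x y /\ continuity_2d_pt u12 x y) /\
    (continuity_2d_pt u2 x y /\ ex_derive (fun z => u2 z y) x /\ ex_derive (fun z => u2 x z) y /\
      continuity_2d_pt u21 x y /\ continuity_2d_pt u22 x y)).
  { intros x y Hxy. generalize (H2 x y Hxy). simpl. intuition. }
  (* Symmetry of the mixed derivatives lets [u12] serve in both orders. *)
  assert (HS : forall x y, (x, y) <> (0, 0) -> u12 x y = u21 x y).
  { intros x y Hxy. symmetry. apply Schwarz.
    - destruct (locally_2d_punctured _ _ Hxy) as [d Hd].
      exists d. intros a b Ha Hb. specialize (Hall a b (Hd a b Ha Hb)).
      unfold u1, u2 in Hall. intuition.
    - now destruct (Hall x y Hxy) as (_ & _ & (_ & _ & _ & H & _)).
    - now destruct (Hall x y Hxy) as (_ & (_ & _ & _ & _ & H) & _). }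
  assert (D1 : forall x y, (x, y) <> (0, 0) -> is_derive (fun z => u z y) x (u1 x y)).
  { intros x y Hxy. destruct (Hall x y Hxy) as ((H & _) & _). now apply Derive_correct. }
  assert (D2 : forall x y, (x, y) <> (0, 0) -> is_derive (fun z => u x z) y (u2 x y)).
  { intros x y Hxy. destruct (Hall x y Hxy) as ((_ & H) & _). now apply Derive_correct. }
  assert (D11 : forall x y, (x, y) <> (0, 0) -> is_derive (fun z => u1 z y) x (u11 x y)).
  { intros x y Hxy. destruct (Hall x y Hxy) as (_ & (_ & H & _) & _). now apply Derive_correct. }
  assert (D12 : forall x y, (x, y) <> (0, 0) -> is_derive (fun z => u1 x z) y (u12 x y)).
  { intros x y Hxy. destruct (Hall x y Hxy) as (_ & (_ & _ & H & _) & _). now apply Derive_correct. }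
  assert (D21 : forall x y, (x, y) <> (0, 0) -> is_derive (fun z => u2 z y) x (u12 x y)).
  { intros x y Hxy. rewrite HS by exact Hxy. destruct (Hall x y Hxy) as (_ & _ & (_ & H & _)). now apply Derive_correct. }
  assert (D22 : forall x y, (x, y) <> (0, 0) -> is_derive (fun z => u2 x z) y (u22 x y)).
  { intros x y Hxy. destruct (Hall x y Hxy) as (_ & _ & (_ & _ & H & _)). now apply Derive_correct. }
  assert (C1 : forall x y, (x, y) <> (0, 0) -> continuity_2d_pt u1 x y).
  { intros x y Hxy. now destruct (Hall x y Hxy) as (_ & (H & _) & _). }
  assert (C2 : forall x y, (x, y) <> (0, 0) -> continuity_2d_pt u2 x y).
  { intros x y Hxy. now destruct (Hall x y Hxy) as (_ & _ & (H & _)). }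
  assert (C11 : forall x y, (x, y) <> (0, 0) -> continuity_2d_pt u11 x y).
  { intros x y Hxy. now destruct (Hall x y Hxy) as (_ & (_ & _ & _ & H & _) & _). }
  assert (C12 : forall x y, (x, y) <> (0, 0) -> continuity_2d_pt u12 x y).
  { intros x y Hxy. now destruct (Hall x y Hxy) as (_ & (_ & _ & _ & _ & H) & _). }
  assert (C22 : forall x y, (x, y) <> (0, 0) -> continuity_2d_pt u22 x y).
  { intros x y Hxy. now destruct (Hall x y Hxy) as (_ & _ & (_ & _ & _ & _ & H)). }
  set (X := polar_x). set (Y := polar_y).
  set (U1 := fun t s => u1 (X t s) (Y t s)). set (U2 := fun t s => u2 (X t s) (Y t s)).
  set (U11 := fun t s => u11 (X t s) (Y t s)). set (U12 := fun t s => u12 (X t s) (Y t s)).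
  set (U22 := fun t s => u22 (X t s) (Y t s)).
  assert (Ct : forall f fx fy, (forall x y, (x, y) <> (0, 0) -> is_derive (fun a => f a y) x (fx x y)) ->
    (forall x y, (x, y) <> (0, 0) -> is_derive (fun a => f x a) y (fy x y)) ->
    (forall x y, (x, y) <> (0, 0) -> continuity_2d_pt fx x y) ->
    forall t s, is_derive (fun z => f (X z s) (Y z s)) t
      (X t s * fx (X t s) (Y t s) + Y t s * fy (X t s) (Y t s))).
  { intros f fx fy F1 F2 F3 t s.
    apply (punctured_chain_rule f fx fy (fun z => X z s) (fun z => Y z s)); try assumption.
    - apply is_derive_polar_x_t.
    - apply is_derive_polar_y_t.
    - apply polar_neq_0. }
  assert (Cs : forall f fx fy, (forall x y, (x, y) <> (0, 0) -> is_derive (fun a => f a y) x (fx x y)) ->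
    (forall x y, (x, y) <> (0, 0) -> is_derive (fun a => f x a) y (fy x y)) ->
    (forall x y, (x, y) <> (0, 0) -> continuity_2d_pt fx x y) ->
    forall t s, is_derive (fun z => f (X t z) (Y t z)) s
      (- Y t s * fx (X t s) (Y t s) + X t s * fy (X t s) (Y t s))).
  { intros f fx fy F1 F2 F3 t s.
    apply (punctured_chain_rule f fx fy (fun z => X t z) (fun z => Y t z)); try assumption.
    - apply is_derive_polar_x_s.
    - apply is_derive_polar_y_s.
    - apply polar_neq_0. }
  assert (Prod : forall (f g h k : R -> R) f' g' h' k' x l,
    is_derive f x f' -> is_derive g x g' -> is_derive h x h' -> is_derive k x k' ->
    l = f' * g x + f x * g' + (h' * k x + h x * k') ->
    is_derive (fun z => f z * g z + h z * k z) x l).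
  { intros f g h k f' g' h' k' x l Hf Hg Hh Hk ->.
    apply (is_derive_plus (fun z => f z * g z) (fun z => h z * k z)).
    - apply (is_derive_mult f g); try assumption. intros; apply Rmult_comm.
    - apply (is_derive_mult h k); try assumption. intros; apply Rmult_comm. }
  assert (DNY : forall t s, is_derive (fun z => - Y z s) t (- Y t s))
    by (intros; apply (is_derive_opp (fun z => Y z s)), is_derive_polar_y_t).
  assert (DNYs : forall t s, is_derive (fun z => - Y t z) s (- X t s))
    by (intros; apply (is_derive_opp (fun z => Y t z)), is_derive_polar_y_s).
  assert (cX : forall t s, continuity_2d_pt X t s) by apply continuity_polar_x.
  assert (cY : forall t s, continuity_2d_pt Y t s) by apply continuity_polar_y.
  assert (cU : forall f, (forall x y, (x, y) <> (0, 0) -> continuity_2d_pt f x y) ->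
    forall t s, continuity_2d_pt (fun t s => f (X t s) (Y t s)) t s)
    by (intros; now apply continuity_polar_comp).
  assert (P0 : forall t, X t (2 * PI) = X t 0 /\ Y t (2 * PI) = Y t 0).
  { intros t. unfold X, Y, polar_x, polar_y. rewrite cos_2PI, sin_2PI, cos_0, sin_0. tauto. }
  exists (fun t s => X t s * U1 t s + Y t s * U2 t s).
  exists (fun t s => - Y t s * U1 t s + X t s * U2 t s).
  exists (fun t s => X t s * U1 t s + X t s * (X t s * U11 t s + Y t s * U12 t s)
                     + (Y t s * U2 t s + Y t s * (X t s * U12 t s + Y t s * U22 t s))).
  exists (fun t s => - Y t s * U1 t s + X t s * (- Y t s * U11 t s + X t s * U12 t s)
                     + (X t s * U2 t s + Y t s * (- Y t s * U12 t s + X t s * U22 t s))).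
  exists (fun t s => - X t s * U1 t s + - Y t s * (- Y t s * U11 t s + X t s * U12 t s)
                     + (- Y t s * U2 t s + X t s * (- Y t s * U12 t s + X t s * U22 t s))).
  cbv zeta. split; [|split; [|split]].
  - split; intros t s;
      try (repeat first [ apply cX | apply cY | apply continuity_2d_pt_plus
        | apply continuity_2d_pt_mult | apply continuity_2d_pt_opp | apply cU; assumption ]; fail);
      try (apply cU; intros; apply Hc).
    + now apply Ct.
    + now apply Cs.
    + eapply Prod; [apply is_derive_polar_x_t | apply (Ct u1 u11 u12); assumption
        | apply is_derive_polar_y_t | apply (Ct u2 u12 u22); assumption | reflexivity].
    + eapply Prod; [apply is_derive_polar_x_s | apply (Cs u1 u11 u12); assumption
        | apply is_derive_polar_y_s | apply (Cs u2 u12 u22); assumption | reflexivity].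
    + eapply Prod; [apply DNY | apply (Ct u1 u11 u12); assumption
        | apply is_derive_polar_x_t | apply (Ct u2 u12 u22); assumption |].
      unfold U1, U2, U11, U12, U22, X, Y; ring.
    + eapply Prod; [apply DNYs | apply (Cs u1 u11 u12); assumption
        | apply is_derive_polar_x_s | apply (Cs u2 u12 u22); assumption | reflexivity].
  - intros t s.
    assert (E := Heq _ _ (polar_neq_0 t s)).
    change (laplacian u (polar_x t s) (polar_y t s)) with (U11 t s + U22 t s) in E.
    assert (He := exp_pos t). assert (Hsq := polar_sq t s).
    assert (Hen : enorm (polar_x t s) (polar_y t s) ^ 2 = exp t ^ 2).
    { unfold enorm. rewrite pow2_sqrt; [exact Hsq|]. rewrite Hsq. apply pow2_ge_0. }
    rewrite Hen in E.
    assert (HL : U11 t s + U22 t s = - (2 / exp t ^ 2 * u (polar_x t s) (polar_y t s)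
                                       * (1 - u (polar_x t s) (polar_y t s) ^ 2))) by lra.
    transitivity ((polar_x t s ^ 2 + polar_y t s ^ 2) * (U11 t s + U22 t s)).
    + unfold X, Y; ring.
    + rewrite HL, Hsq. unfold X, Y. field. lra.
  - intros t. destruct (P0 t) as [E1 E2]. unfold U1, U2. now rewrite E1, E2.
  - intros t. destruct (P0 t) as [E1 E2]. unfold U1, U2. now rewrite E1, E2.
Qed.

(** * Return to the plane and extension across the origin *)

Lemma continuous_zero_at_origin (f : R -> R -> R) :
  continuity_2d_pt f 0 0 -> (forall x y, (x, y) <> (0, 0) -> f x y = 0) -> f 0 0 = 0.
Proof.
  intros Hc Hf. destruct (Req_dec (f 0 0) 0) as [E|E]; [exact E|exfalso].
  apply Rabs_pos_lt in E.
  destruct (Hc (mkposreal _ E)) as [d Hd]. assert (Hdp := cond_pos d).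
  specialize (Hd (d / 2) 0). rewrite Hf in Hd by (intros Heq; injection Heq; lra).
  rewrite !Rminus_0_r, Rminus_0_l, Rabs_R0, Rabs_Ropp in Hd.
  rewrite (Rabs_right (d / 2)) in Hd by lra.
  apply (Rlt_irrefl (Rabs (f 0 0))), Hd; lra.
Qed.

Lemma continuous_zero_plane (f : R -> R -> R) :
  continuity_2d_pt f 0 0 -> (forall x y, (x, y) <> (0, 0) -> f x y = 0) ->
  forall x y, f x y = 0.
Proof.
  intros Hc Hf x y.
  destruct (classic ((x, y) = (0, 0))) as [E|E]; [|now apply Hf].
  injection E as -> ->. now apply continuous_zero_at_origin.
Qed.

(** Since [exp t] is the radius, the relation is algebraic in [u] and [x^2 + y^2], and continuity
    extends it to the origin. The value [v0 = -1] gives [u = -1], and [v0 = 1] gives [u = 1], the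
    opposite of the profile with [a = 0]; otherwise [a^2 = (1 + v0) / (1 - v0)]. *)
Lemma moebius_profile (u : R -> R -> R) (v0 : R) :
  continuous_plane u -> -1 <= v0 <= 1 ->
  moebius_relation (fun t s => u (polar_x t s) (polar_y t s)) v0 ->
  exists a, (forall x y, u x y = profile a x y) \/ (forall x y, u x y = - profile a x y).
Proof.
  intros Hc Hv0 HM.
  assert (Hcu : forall k, continuity_2d_pt (fun x y => k + u x y) 0 0).
  { intros k. apply continuity_2d_pt_plus; [apply continuity_2d_pt_const | apply Hc]. }
  assert (Hrel : forall x y, (x, y) <> (0, 0) ->
    (1 + v0) * (1 - u x y) - (1 - v0) * (1 + u x y) * (x ^ 2 + y ^ 2) = 0).
  { intros x y Hxy. destruct (polar_surjective x y Hxy) as (t & s & Hs & -> & ->).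
    rewrite polar_sq. specialize (HM t s Hs). simpl in HM |- *. lra. }
  destruct (Req_dec v0 (-1)) as [->|H1].
  - exists 0. left. intros x y. unfold profile.
    destruct (Req_EM_T 0 0) as [_|N]; [|now contradiction N].
    enough (1 + u x y = 0) by lra. revert x y.
    apply (continuous_zero_plane (fun x y => 1 + u x y)); [apply Hcu|].
    intros x y Hxy. specialize (Hrel x y Hxy).
    assert (0 < x ^ 2 + y ^ 2).
    { destruct (Req_dec x 0) as [->|Hx].
      - assert (y <> 0) by (intros ->; now apply Hxy). nra.
      - nra. }
    apply (Rmult_eq_reg_r (x ^ 2 + y ^ 2)); lra.
  - destruct (Req_dec v0 1) as [->|H2].
    + exists 0. right. intros x y. unfold profile.
      destruct (Req_EM_T 0 0) as [_|N]; [|now contradiction N].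
      enough (-1 + u x y = 0) by lra. revert x y.
      apply (continuous_zero_plane (fun x y => -1 + u x y)); [apply Hcu|].
      intros x y Hxy. specialize (Hrel x y Hxy). lra.
    + assert (Hq : 0 < (1 + v0) / (1 - v0)) by (apply Rdiv_lt_0_compat; lra).
      exists (sqrt ((1 + v0) / (1 - v0))). left.
      assert (Ha := sqrt_lt_R0 _ Hq).
      intros x y. unfold profile.
      destruct (Req_EM_T (sqrt ((1 + v0) / (1 - v0))) 0) as [E|_]; [lra|].
      assert (Hr : 0 <= x ^ 2 + y ^ 2) by nra.
      unfold enorm. rewrite !pow2_sqrt by lra.
      assert (Hz : (1 + v0) * (1 - u x y) - (1 - v0) * (1 + u x y) * (x ^ 2 + y ^ 2) = 0).
      { clear Hr; revert x y. apply continuous_zero_plane; [|exact Hrel].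
        repeat first [ apply Hc | apply continuity_2d_pt_const | apply continuity_2d_pt_minus
          | apply continuity_2d_pt_plus | apply continuity_2d_pt_mult | apply continuity_2d_pt_pow
          | apply continuity_2d_pt_id1 | apply continuity_2d_pt_id2 ]. }
      set (r2 := x ^ 2 + y ^ 2) in *.
      assert (Hd : 0 < 1 + v0 + (1 - v0) * r2).
      { assert (0 <= (1 - v0) * r2) by (apply Rmult_le_pos; lra). lra. }
      apply (Rmult_eq_reg_r (1 + v0 + (1 - v0) * r2)); [|lra].
      transitivity (1 + v0 - (1 - v0) * r2); [lra|].
      field. split; lra.
Qed.

Lemma profile_radial (a x1 y1 x2 y2 : R) :
  enorm x1 y1 = enorm x2 y2 -> profile a x1 y1 = profile a x2 y2.
Proof. intros H. unfold profile. now rewrite H. Qed.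

Theorem theorem1p3 (u : R -> R -> R)
  (u_C2 : C2_punctured_plane u)
  (u_cont : continuous_plane u)
  (u_bounded : bounded_plane u)
  (u_eq : forall x y : R, (x, y) <> (0, 0) ->
     - laplacian u x y = 2 / enorm x y ^ 2 * u x y * (1 - u x y ^ 2)) :
  radially_symmetric u /\
  ((forall x y : R, u x y = 0) \/
   (exists a : R,
      (forall x y : R, u x y = profile a x y) \/
      (forall x y : R, u x y = - profile a x y))).
Proof.
  (* Radial symmetry follows from the classification, since the profiles depend on [enorm] alone. *)
  enough (H : (forall x y : R, u x y = 0) \/
    (exists a : R, (forall x y : R, u x y = profile a x y) \/
                   (forall x y : R, u x y = - profile a x y))).
  { split; [|exact H]. intros x1 y1 x2 y2 Hr.
    destruct H as [H|[a [H|H]]]; rewrite !H; [reflexivity|..];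
      now rewrite (profile_radial a x1 y1 x2 y2 Hr). }
  destruct (polar_jet u u_C2 u_cont u_eq) as (vt & vs & vtt & vts & vss & J & E & Pt & Ps).
  destruct u_bounded as [M HM].
  assert (Hv := bounded_solution_abs_le_1 _ _ _ _ _ _ M J E (fun t s => HM _ _)).
  simpl in Hv.
  destruct (cylinder_classification _ _ _ _ _ _ (u 0 0) J E Hv) as [H|[H|H]]; try assumption.
  - intros t. simpl. unfold polar_x, polar_y.
    now rewrite cos_2PI, sin_2PI, cos_0, sin_0.
  - intros eta Heta. destruct (u_cont 0 0 (mkposreal eta Heta)) as [d Hd].
    assert (Hdp := cond_pos d).
    (* For [t < ln d] the radius [exp t] is below [d], uniformly in the angle. *)
    exists (ln d). intros t s Ht. apply Hd; rewrite Rminus_0_r.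
    + assert (Hlt : exp t < d) by (rewrite <- (exp_ln d) by lra; now apply exp_increasing).
      unfold polar_x. rewrite Rabs_mult, (Rabs_right (exp t)) by (apply Rle_ge, Rlt_le, exp_pos).
      assert (Rabs (cos s) <= 1) by (apply Rabs_le, COS_bound).
      assert (Hp := exp_pos t). nra.
    + assert (Hlt : exp t < d) by (rewrite <- (exp_ln d) by lra; now apply exp_increasing).
      unfold polar_y. rewrite Rabs_mult, (Rabs_right (exp t)) by (apply Rle_ge, Rlt_le, exp_pos).
      assert (Rabs (sin s) <= 1) by (apply Rabs_le, SIN_bound).
      assert (Hp := exp_pos t). nra.
  - left. apply continuous_zero_plane; [apply u_cont|].
    intros x y Hxy. destruct (polar_surjective x y Hxy) as (t & s & Hs & -> & ->).
    now apply H.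
  - right. destruct H as [v0 [Hv0 H]]. now apply (moebius_profile u v0).
  - right. destruct H as [v0 [Hv0 H]].
    (* The relation holds for [- u], so the two signs are exchanged. *)
    destruct (moebius_profile (fun x y => - u x y) v0) as [a [Ha|Ha]]; try assumption.
    + intros x y. apply continuity_2d_pt_opp, u_cont.
    + exists a. right. intros x y. specialize (Ha x y). lra.
    + exists a. left. intros x y. specialize (Ha x y). lra.
Qed.
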